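(* Let $k$ be an algebraically closed field of characteristic $0$. Let $G$ be a finite group, $H$ a subgroup of $G$, $V$ an irreducible projective representation of $H$ over $k$ satisfying $\dim V=|H|^{1/2}$, and $u\in G$ a central element of order $\le 2$. Then the triangular Hopf algebra $F(G,H,V,u)$ is minimal if and only if $G$ is generated by $H$ and $u$.
   Context: A finite-dimensional triangular Hopf algebra $(A,R)$ is minimal if the left (and right) tensor components of $R$ span $A$, i.e. $\{(f\otimes I)(R): f\in A^*\}=A=\{(I\otimes f)(R): f\in A^*\}$. Twists. A twist for a Hopf algebra $A$ over $k$ is an invertible element $J\in A\otimes A$ with $(\Delta\otimes I)(J)\,J_{12}=(I\otimes\Delta)(J)\,J_{23}$ and $(\varepsilon\otimes I)(J)=(I\otimes\varepsilon)(J)=1$, where $J_{12}=J\otimes 1$, $J_{23}=1\otimes J$ and $I$ is the identity map. The twisted Hopf algebra $A^J$ is $A$ as an algebra, with the same counit and coproduct $\Delta^J(x)=J^{-1}\Delta(x)J$. If $A$ is triangular with universal $R$-matrix $R$, then $A^J$ is triangular with universal $R$-matrix $J_{21}^{-1}RJ$, where $J_{21}$ is $J$ with its tensor factors exchanged. A group algebra is triangular with $R=1\otimes 1$. Twist attached to $(H,V)$. Let $H$ be a finite group with $|H|$ not divisible by the characteristic of $k$, and $V$ an irreducible projective representation of $H$ over $k$, given by $\pi:H\to PGL(V)$, with $\dim V=|H|^{1/2}$. Then $H$ acts on the algebra $End_k(V)$ by conjugation via $\pi$, and hence on the dual coalgebra $(End_kV)^*$ (with comultiplication $\Delta$ dual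 to the multiplication of $End_k V$); both are isomorphic to the regular representation of $H$. Choose $\lambda\in(End_kV)^*$ such that $\{a\cdot\lambda: a\in H\}$ is a basis of $(End_kV)^*$ and $\langle\lambda,\mathrm{id}_V\rangle=1$. Write $\Delta(\lambda)=\sum_{a,b\in H}\gamma(a,b)\,a\cdot\lambda\otimes b\cdot\lambda$ and set $J=\sum_{a,b\in H}\gamma(a,b)\,a\otimes b\in k[H]\otimes k[H]$. This is a twist for $k[H]$, and different choices of $\lambda$ give gauge equivalent twists (twists $J$ and $\Delta(x)J(x^{-1}\otimes x^{-1})$, $x$ invertible in $k[H]$, are gauge equivalent). The assignment $F$. For a finite group $G\supseteq H$ whose order is not divisible by the characteristic of $k$, $F(G,H,V)=(k[G]^J,J_{21}^{-1}J)$. For a central element $u\in G$ of order $\le 2$ set $R_u=\frac12(1\otimes 1+1\otimes u+u\otimes 1-u\otimes u)$ (in characteristic $0$). With $(A,R)=F(G,H,V)$, define $F(G,H,V,u)=(A,RR_u)$, considered up to isomorphism of triangular Hopf algebras. *)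

(* Defs.v *)
From HB Require Import structures.
From mathcomp Require Import all_boot all_order all_algebra.
From mathcomp Require Import all_fingroup all_solvable all_field.

Set Implicit Arguments.
Unset Strict Implicit.
Unset Printing Implicit Defensive.

Import GRing.Theory.

Local Open Scope ring_scope.

(* The direct product of two groups, as a structure on the type (gT * hT). *)
Notation prodg := Datatypes_prod__canonical__fingroup_FinGroup (only parsing).

(* The group algebra k[G]: functions G -> k under convolution.  It is an alias
   because {ffun gT -> k} already carries the pointwise product. *)
Definition galg (k : fieldType) (gT : finGroupType) := {ffun gT -> k}.

HB.instance Definition _ (k : fieldType) (gT : finGroupType) :=
  Vector.copy (galg k gT) {ffun gT -> k^o}.

Section GroupAlgebra.

Variables (k : fieldType) (gT : finGroupType).
Local Notation A := (galg k gT).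
Implicit Types (a b c : A) (x y z : gT).

Definition gelt x : A := [ffun y => (y == x)%:R].

Definition galg_mul a b : A := [ffun x => \sum_y a y * b (y^-1 * x)%g].

Fact galg_mulA : associative galg_mul.
Proof.
move=> a b c; apply/ffunP=> x; rewrite !ffunE.
under eq_bigr => y _ do rewrite ffunE mulr_sumr.
under [RHS]eq_bigr => y _ do rewrite ffunE mulr_suml.
rewrite [RHS]exchange_big /=; apply: eq_bigr => y _.
rewrite [RHS](reindex (fun z => (y * z)%g)) /=; last first.
  by exists (fun z => (y^-1 * z)%g) => z _; rewrite (mulKg, mulKVg).
by apply: eq_bigr => z _; rewrite mulrA mulKg invMg mulgA.
Qed.

Fact galg_mul1a : left_id (gelt 1%g) galg_mul.
Proof.
move=> a; apply/ffunP=> x; rewrite ffunE (bigD1 1%g) //= ffunE eqxx mul1r.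
rewrite invg1 mul1g big1 ?addr0 // => y /negPf y1.
by rewrite ffunE y1 mul0r.
Qed.

Fact galg_mula1 : right_id (gelt 1%g) galg_mul.
Proof.
move=> a; apply/ffunP=> x; rewrite ffunE (bigD1 x) //= ffunE mulVg eqxx mulr1.
rewrite big1 ?addr0 // => y /negPf yx.
by rewrite ffunE -eq_mulVg1 yx mulr0.
Qed.

Fact galg_mulDl : left_distributive galg_mul +%R.
Proof.
move=> a b c; apply/ffunP=> x; rewrite !ffunE -big_split /=.
by apply: eq_bigr => y _; rewrite !ffunE mulrDl.
Qed.

Fact galg_mulDr : right_distributive galg_mul +%R.
Proof.
move=> a b c; apply/ffunP=> x; rewrite !ffunE -big_split /=.
by apply: eq_bigr => y _; rewrite !ffunE mulrDr.
Qed.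

Fact galg_1neq0 : gelt 1%g != 0.
Proof.
by apply/eqP=> /ffunP/(_ 1%g)/eqP; rewrite !ffunE eqxx oner_eq0.
Qed.

HB.instance Definition _ := GRing.Zmodule_isNzRing.Build (galg k gT)
  galg_mulA galg_mul1a galg_mula1 galg_mulDl galg_mulDr galg_1neq0.

Fact galg_scaleAl (t : k) a b : t *: (a * b) = (t *: a) * b.
Proof.
apply/ffunP=> x; rewrite !ffunE scaler_sumr; apply: eq_bigr => y _.
by rewrite !ffunE; apply: mulrA.
Qed.

HB.instance Definition _ :=
  GRing.Lmodule_isLalgebra.Build k (galg k gT) galg_scaleAl.

Fact galg_scaleAr (t : k) a b : t *: (a * b) = a * (t *: b).
Proof.
apply/ffunP=> x; rewrite !ffunE scaler_sumr; apply: eq_bigr => y _.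
by rewrite !ffunE; apply: mulrCA.
Qed.

HB.instance Definition _ :=
  GRing.Lalgebra_isAlgebra.Build k (galg k gT) galg_scaleAr.

(* This equips k[G] with the inverse a^-1 of its invertible elements. *)
HB.instance Definition _ := Algebra_isFalgebra.Build k (galg k gT).

End GroupAlgebra.

Arguments gelt k {gT} x.

Section TensorPowers.

Variables (k : fieldType) (gT : finGroupType).
Local Notation A := (galg k gT).

(* The algebras k[G] (x) k[G] and k[G] (x) k[G] (x) k[G] are identified with
   k[G * G] and k[G * G * G]: the tensor g (x) h is the group element (g, h). *)
Local Notation A2 := (galg k (prodg gT gT)).
Local Notation A3 := (galg k (prodg (prodg gT gT) gT)).

Definition tens (a b : A) : A2 := [ffun p => a p.1 * b p.2].

Definition flip (X : A2) : A2 := [ffun p => X (p.2, p.1)].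

Definition leg12 (X : A2) : A3 :=
  [ffun p => X (p.1.1, p.1.2) * (p.2 == 1%g)%:R].
Definition leg13 (X : A2) : A3 :=
  [ffun p => X (p.1.1, p.2) * (p.1.2 == 1%g)%:R].
Definition leg23 (X : A2) : A3 :=
  [ffun p => X (p.1.2, p.2) * (p.1.1 == 1%g)%:R].

(* D (x) I and I (x) D, for D : A -> A (x) A: apply D to the slices of X. *)
Definition map_left (D : A -> A2) (X : A2) : A3 :=
  [ffun p => D [ffun x => X (x, p.2)] p.1].
Definition map_right (D : A -> A2) (X : A2) : A3 :=
  [ffun p => D [ffun y => X (p.1.1, y)] (p.1.2, p.2)].

(* f (x) I and I (x) f, for f : A -> k. *)
Definition contract_left (f : A -> k) (X : A2) : A :=
  [ffun y => f [ffun x => X (x, y)]].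
Definition contract_right (f : A -> k) (X : A2) : A :=
  [ffun x => f [ffun y => X (x, y)]].

(* Twisting leaves the algebra unchanged, so every Hopf algebra considered
   here lives on the algebra k[G]; only the data below vary. *)
Record hopf_data := HopfData {
  comul : A -> A2;
  counit : A -> k;
  rmat : A2
}.

Implicit Type T : hopf_data.

Definition is_bialgebra T : Prop :=
  [/\ linear (comul T) /\ linear (counit T : A -> k^o),
      comul T 1 = 1 /\ (forall a b, comul T (a * b) = comul T a * comul T b),
      counit T 1 = 1 /\
        (forall a b, counit T (a * b) = counit T a * counit T b),
      forall a, map_left (comul T) (comul T a)
                = map_right (comul T) (comul T a)
    & forall a, contract_left (counit T) (comul T a) = a /\
                contract_right (counit T) (comul T a) = a].

(* The product of A composed with f (x) g. *)
Definition mul_map (f g : A -> A) (X : A2) : A :=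
  \sum_(p : gT * gT) X p *: ((f (gelt k p.1) * g (gelt k p.2)) : A).

Definition has_antipode T : Prop :=
  exists2 S : A -> A, linear S &
    forall a,
      mul_map S id (comul T a) = counit T a *: (1 : A) /\
      mul_map id S (comul T a) = counit T a *: (1 : A).

Definition is_triangular_rmat T : Prop :=
  let R := rmat T in
  [/\ R \is a GRing.unit,
      forall a, R * comul T a = flip (comul T a) * R,
      map_left (comul T) R = leg13 R * leg23 R,
      map_right (comul T) R = leg13 R * leg12 R
    & flip R * R = 1].

Definition is_triangular_hopf T : Prop :=
  [/\ is_bialgebra T, has_antipode T & is_triangular_rmat T].

Definition is_minimal T : Prop :=
  [/\ is_triangular_hopf T,
      forall a : A, exists f : 'Hom(A, k^o), contract_left f (rmat T) = a
    & forall a : A, exists f : 'Hom(A, k^o), contract_right f (rmat T) = a].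

(* k[G] with x |-> x (x) x on group elements and R = 1 (x) 1. *)
Definition group_hopf : hopf_data := {|
  comul := fun a => \sum_x a x *: tens (gelt k x) (gelt k x);
  counit := fun a => \sum_x a x;
  rmat := tens 1 1
|}.

Definition twist_hopf T (J : A2) : hopf_data := {|
  comul := fun a => J^-1 * comul T a * J;
  counit := counit T;
  rmat := (flip J)^-1 * rmat T * J
|}.

End TensorPowers.

Section ProjectiveRepresentation.

Variables (k : fieldType) (gT : finGroupType) (H : {group gT}).
Variable V : vectType k.

(* A homomorphism H -> PGL(V), given by a lift rho : H -> GL(V) (the values of
   rho outside H are irrelevant). *)
Definition is_proj_repr (rho : gT -> 'End(V)) : Prop :=
  {in H, forall x, lker (rho x) == 0%VS} /\
  {in H &, forall x y,
    exists2 c : k, c != 0 & rho (x * y)%g = c *: (rho x \o rho y)%VF}.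

Definition is_proj_irr (rho : gT -> 'End(V)) : Prop :=
  [/\ is_proj_repr rho, (fullv : {vspace V}) != 0%VS
    & forall U : {vspace V}, {in H, forall x, (rho x @: U <= U)%VS} ->
        U = 0%VS \/ U = fullv].

(* The action of H on (End V)^*, dual to conjugation X |-> x X x^-1. *)
Definition dual_act (rho : gT -> 'End(V)) (x : gT)
    (lam : 'Hom('End(V), k^o)) : 'Hom('End(V), k^o) :=
  linfun (fun X : 'End(V) => lam ((rho x)^-1 \o X \o rho x)%VF).

Definition is_dual_generator (rho : gT -> 'End(V))
    (lam : 'Hom('End(V), k^o)) : Prop :=
  basis_of fullv [seq dual_act rho x lam | x <- enum H] /\ lam \1%VF = 1.

(* Delta(lam) = sum gamma(a,b) a.lam (x) b.lam, where Delta(lam), seen in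
   (End V (x) End V)^*, is X (x) Y |-> lam (X Y). *)
Definition is_comul_coef (rho : gT -> 'End(V)) (lam : 'Hom('End(V), k^o))
    (gamma : gT -> gT -> k) : Prop :=
  forall X Y : 'End(V),
    lam (X \o Y)%VF =
      \sum_(a in H) \sum_(b in H)
         gamma a b * (dual_act rho a lam X * dual_act rho b lam Y).

Definition proj_twist (gamma : gT -> gT -> k) : galg k (prodg gT gT) :=
  \sum_(a in H) \sum_(b in H) gamma a b *: tens (gelt k a) (gelt k b).

End ProjectiveRepresentation.

Section AssignmentF.

Variables (k : fieldType) (gT : finGroupType) (H : {group gT}).

Definition Ru (u : gT) : galg k (prodg gT gT) :=
  2%:R^-1 *: (tens 1 1 + tens 1 (gelt k u) + tens (gelt k u) 1
              - tens (gelt k u) (gelt k u)).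

(* F(G, H, V), with G = gT; V enters through the coefficients gamma of the
   chosen functional lam, see is_comul_coef. *)
Definition FHV (gamma : gT -> gT -> k) : hopf_data k gT :=
  twist_hopf (group_hopf k gT) (proj_twist H gamma).

(* F(G, H, V, u). *)
Definition FHVu (gamma : gT -> gT -> k) (u : gT) : hopf_data k gT :=
  let T := FHV gamma in
  {| comul := comul T; counit := counit T; rmat := rmat T * Ru u |}.

End AssignmentF.

(* Main.v *)
Require Import Defs.
From HB Require Import structures.
From mathcomp Require Import all_boot all_order all_algebra.
From mathcomp Require Import all_fingroup all_solvable all_field.
Import GRing.Theory.
Local Open Scope ring_scope.

(** Let H act on M = End V by X^h = r(h)^-1 X r(h), so that h.lam is the
functional X |-> lam(X^h), and let n = dim V, where |H| = n^2.  The twist J is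
characterised by sum_(a,b) J(a,b) lam(X^a) lam(Y^b) = lam(X Y).  As the h.lam
form a basis of the dual of M, an element of k[H x H] or k[H x H x H] is
determined by its pairings with products of such functionals (lamH2_inj,
lamH3_inj), and the twist identities of J amount to associativity and unit of M
(twist_twist, twist_fst, twist_snd).

Freeness of the orbit of lam makes the invariants of M scalar, and comparing
traces gives sum_h X^h = tau(X) 1 with tau = n tr (twirl).  Choose L with
lam(X) = tau(X L).  Then lam(X) lam(Y) = lam(X tau(Y L)) =
sum_h lam(X Y^h L^h), and expanding the functionals Z |-> lam(Z L^h) in the
basis of the y.lam turns this identity into an explicit inverse of J.  The same
coefficients show that R = J_21^-1 J is, as a bilinear form on M,
beta(A, B) = sum_h lam(A^h B L^h) (twist_inverse).

This form is nondegenerate.  Since beta(A, B) = tau(B sum_h L^h L A^h), an A in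
its kernel makes the equivariant map Z |-> sum_h L^h Z A^h vanish at L, hence
everywhere, because the L^g span M.  Its tau-adjoint W |-> sum_h A^h W L^h then
vanishes too; evaluating at W = r(g), multiplying by r(g)^-1 W' and summing over
g leaves sum_h tau(W' A^h) L^h = 0, so A = 0 because the L^h are independent
(twisted_sum_eq0).  For u in H the factor R_u only inserts signs on the two
eigenspaces of u in M, and the same argument runs on each of them
(beta_Ru_nondeg).  If u is outside H and together with H generates G, then G is
the disjoint union of H and Hu, and the contraction of R R_u with f decouples
into the contractions of R with f(x) + f(xu) and f(x) - f(xu) (R_Ru_nondeg).  So
when H and u generate G the contractions of R R_u are onto.  Conversely J, its
inverse and R_u are supported on the subgroup generated by H and u, so all
contractions are, and minimality forces this subgroup to be G (matrix_minimal).

It remains that a twist of k[G], multiplied by R_u, yields a triangular Hopf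
algebra.  Every structure map of k[G] is the linear extension of a map of groups
(gpush), so the axioms become permuted copies of the twist identity
(twist_perm_inv); the antipode is the inversion of G conjugated by
Q = sum S(J_1) J_2, whose invertibility also comes from the twist identity
(antipode_unit). *)

Set Implicit Arguments.
Unset Strict Implicit.
Unset Printing Implicit Defensive.

(** * Group algebras and linear extensions of group maps *)

Section Gelt.
Variables (k : fieldType) (gT : finGroupType).
Implicit Types (a b : galg k gT) (x y : gT).

Lemma galgE a : a = \sum_x a x *: gelt k x.
Proof.
apply/ffunP => y; rewrite sum_ffunE (bigD1 y) //= big1 => [|x xy].
  by rewrite !ffunE eqxx addr0; apply/esym/mulr1.
by rewrite !ffunE eq_sym (negPf xy); apply: mulr0.
Qed.

Lemma geltM x y : gelt k x * gelt k y = gelt k (x * y)%g.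
Proof.
apply/ffunP => z; rewrite [LHS]ffunE (bigD1 x) //= big1 => [|t tx].
  by rewrite !ffunE eqxx mul1r addr0 (canF_eq (mulKVg x)).
by rewrite !ffunE (negPf tx) mul0r.
Qed.

Lemma galgM a b :
  a * b = \sum_x \sum_y (a x * b y) *: gelt k (x * y)%g.
Proof.
rewrite {1}[a]galgE mulr_suml; apply: eq_bigr => x _.
rewrite {1}[b]galgE mulr_sumr; apply: eq_bigr => y _.
by rewrite -scalerAl -scalerAr scalerA geltM.
Qed.

(** One-sided inverses are two-sided: right multiplication by [a] is injective,
hence onto, in finite dimension. *)
Lemma galg_unit a b : a * b = 1 -> b * a = 1.
Proof.
move=> ab; have: lker (amulr a) == 0%VS.
  apply/lker0P => x y; rewrite !lfunE /= => e.
  by rewrite -[x]mulr1 -[y]mulr1 -ab !mulrA e.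
move=> /lker0_compfV/lfunP/(_ 1); rewrite !lfunE /= lfunE /=.
set c := (_^-1)%VF _ => ca.
by rewrite -{1}(_ : c = b) // -[b]mul1r -ca -mulrA ab mulr1.
Qed.

Lemma galg_invE a b : a * b = 1 -> a^-1 = b.
Proof.
move=> ab; have ua : a \is a GRing.unit by apply/unitrP; exists b; rewrite galg_unit.
by rewrite -[b]mul1r -(mulVr ua) -mulrA ab mulr1.
Qed.

End Gelt.

Section Push.
Variables (k : fieldType) (gT hT : finGroupType).

(** [phi] need not be a morphism: the antipode is the case of inversion, and
[antipode_unit] uses [(x, y, z) |-> x^-1 y z^-1]. *)
Definition gpush (phi : gT -> hT) (a : galg k gT) : galg k hT :=
  \sum_x a x *: gelt k (phi x).

Fact gpush_is_linear phi : linear (gpush phi).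
Proof.
move=> t a b; rewrite /gpush scaler_sumr -big_split /=; apply: eq_bigr => x _.
by rewrite !ffunE scalerDl scalerA.
Qed.
HB.instance Definition _ phi :=
  GRing.isLinear.Build k (galg k gT) (galg k hT) _ (gpush phi)
    (gpush_is_linear phi).

Lemma gpush_gelt phi x : gpush phi (gelt k x) = gelt k (phi x).
Proof.
rewrite /gpush (bigD1 x) //= big1 => [|y yx]; rewrite ffunE ?eqxx ?scale1r ?addr0//.
by rewrite (negPf yx) scale0r.
Qed.

Lemma gpushE phi a y : gpush phi a y = \sum_(x | phi x == y) a x.
Proof.
rewrite sum_ffunE [RHS]big_mkcond /=; apply: eq_bigr => x _.
by rewrite !ffunE eq_sym; case: eqP => _; [apply: mulr1 | apply: mulr0].
Qed.

Lemma gpush_mul phi a b : {morph phi : x y / (x * y)%g} ->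
  gpush phi (a * b) = gpush phi a * gpush phi b.
Proof.
move=> phiM; rewrite galgM linear_sum mulr_suml; apply: eq_bigr => x _.
rewrite linear_sum mulr_sumr; apply: eq_bigr => y _.
by rewrite linearZ /= gpush_gelt phiM -geltM -scalerAl -scalerAr scalerA.
Qed.

Lemma gpush_1 phi : phi 1%g = 1%g -> gpush phi 1 = 1.
Proof. by move=> phi1; rewrite [LHS](gpush_gelt phi 1%g) phi1. Qed.

End Push.

Lemma gpush_comp (k : fieldType) (gT hT kT : finGroupType)
    (psi : hT -> kT) (phi : gT -> hT) (a : galg k gT) :
  gpush psi (gpush phi a) = gpush (psi \o phi) a.
Proof.
rewrite {2}/gpush linear_sum; apply: eq_bigr => x _.
by rewrite linearZ /= gpush_gelt.
Qed.

Lemma eq_gpush (k : fieldType) (gT hT : finGroupType)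
    (phi psi : gT -> hT) (a : galg k gT) :
  phi =1 psi -> gpush phi a = gpush psi a.
Proof. by move=> e; apply: eq_bigr => x _; rewrite e. Qed.

Lemma gpush_id (k : fieldType) (gT : finGroupType) (a : galg k gT) :
  gpush id a = a.
Proof. by rewrite [RHS]galgE. Qed.

(** As [theta] need not be a morphism, it cannot be distributed over the product;
identities between such images are instead checked on group elements. *)
Lemma gpush_prod (k : fieldType) (gT hT kT lT : finGroupType)
    (theta : kT -> lT) (phi : gT -> kT) (psi : hT -> kT)
    (a : galg k gT) (b : galg k hT) :
  gpush theta (gpush phi a * gpush psi b) =
  \sum_x \sum_y (a x * b y) *: gelt k (theta (phi x * psi y)%g).
Proof.
rewrite mulr_suml linear_sum; apply: eq_bigr => x _.
rewrite mulr_sumr linear_sum; apply: eq_bigr => y _.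
by rewrite -scalerAl -scalerAr scalerA geltM linearZ /= gpush_gelt.
Qed.

Section Pairing.
Variables (k : fieldType) (gT : finGroupType).
Implicit Types (a b : galg k gT) (phi : gT -> k).

Definition gpair phi a : k^o := \sum_x a x * phi x.

Fact gpair_is_linear phi : linear (gpair phi : galg k gT -> k^o).
Proof.
move=> t a b; rewrite /gpair scaler_sumr -big_split; apply: eq_bigr => x _ /=.
by rewrite !ffunE mulrDl; congr (_ + _); apply/esym/mulrA.
Qed.
HB.instance Definition _ phi :=
  GRing.isLinear.Build k (galg k gT) k^o _ (gpair phi) (gpair_is_linear phi).

Lemma gpair_gelt phi x : gpair phi (gelt k x) = phi x.
Proof.
rewrite /gpair (bigD1 x) //= big1 => [|y yx]; rewrite ffunE ?eqxx ?mul1r ?addr0//.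
by rewrite (negPf yx) mul0r.
Qed.

Lemma gpairM phi a b :
  gpair phi (a * b) = \sum_x a x * (\sum_y b y * phi (x * y)%g).
Proof.
rewrite galgM linear_sum; apply: eq_bigr => x _; rewrite linear_sum mulr_sumr.
by apply: eq_bigr => y _; rewrite linearZ /= gpair_gelt mulrA.
Qed.

Lemma eq_gpair phi psi a : (forall x, a x != 0 -> phi x = psi x) ->
  gpair phi a = gpair psi a.
Proof.
move=> e; apply: eq_bigr => x _; have [->|/e->//] := eqVneq (a x) 0.
by rewrite !mul0r.
Qed.

Definition supported (S : {set gT}) a := forall x, x \notin S -> a x = 0.

Lemma supportedP (S : {set gT}) a x : supported S a -> a x != 0 -> x \in S.
Proof. by move=> aS; apply: contraR => /aS ->. Qed.

Lemma supportedM (S : {group gT}) a b :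
  supported S a -> supported S b -> supported S (a * b).
Proof.
move=> aS bS x xS; rewrite ffunE big1 // => y _.
have [/aS->|yS] := boolP (y \notin S); first by rewrite mul0r.
by rewrite (bS (y^-1 * x)%g) ?mulr0 // groupMl ?groupV // -[y \in S]negbK.
Qed.

Lemma supported1 (S : {group gT}) : supported S (1 : galg k gT).
Proof.
move=> x xS; rewrite ffunE (_ : (_ == _) = false) //.
by apply: contraNF xS => /eqP->; apply: group1.
Qed.

Lemma mul_geltE a q x : (a * gelt k q) x = a (x * q^-1)%g.
Proof.
rewrite ffunE (bigD1 (x * q^-1)%g) //= big1 => [|y yx]; last first.
  rewrite ffunE (_ : (_ == q) = false) ?mulr0 //; apply: contraNF yx => /eqP <-.
  by rewrite invMg invgK mulKVg.
by rewrite ffunE invMg invgK mulgKV eqxx mulr1 addr0.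
Qed.

End Pairing.

Lemma gpair_gpush (k : fieldType) (gT hT : finGroupType) (f : gT -> hT)
    (phi : hT -> k) (a : galg k gT) :
  gpair phi (gpush f a) = gpair (phi \o f) a.
Proof.
rewrite /gpush linear_sum; apply: eq_bigr => x _.
by rewrite linearZ /= gpair_gelt.
Qed.

Lemma supported_gpush (k : fieldType) (gT hT : finGroupType) (f : gT -> hT)
    (S : {set gT}) (S' : {set hT}) (a : galg k gT) :
  (forall x, x \in S -> f x \in S') -> supported S a -> supported S' (gpush f a).
Proof.
move=> fS aS y yS; rewrite gpushE big1 // => x /eqP fx; apply: aS.
by apply: contra yS => /fS; rewrite fx.
Qed.

(** * Surjectivity of contractions *)

Section Contractions.
Variables (k : fieldType) (gT : finGroupType).
Local Notation A := (galg k gT).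
Variable N : galg k (prodg gT gT).
Hypothesis N_nondeg : forall f : gT -> k,
  (forall y, \sum_x f x * N (x, y) = 0) -> forall x, f x = 0.

Lemma galg_surj (Psi : A -> A) : linear Psi ->
  (forall f, Psi f = 0 -> f = 0) -> forall a, exists f, Psi f = a.
Proof.
move=> lPsi inj a.
pose F : {linear A -> A} := HB.pack Psi (GRing.isLinear.Build k _ _ _ Psi lPsi).
have: lker (linfun F) == 0%VS.
  apply/eqP/vspaceP => f; rewrite memv_ker memv0 lfunE /=.
  by apply/eqP/eqP => [/inj|->] //; apply: (linear0 F).
move=> /lker0_compfV/lfunP/(_ a); rewrite comp_lfunE id_lfunE lfunE /= => e.
by exists (((linfun F)^-1)%VF a).
Qed.

Lemma contract_left_surj (a : A) : exists f : 'Hom(A, k^o), contract_left f N = a.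
Proof.
pose Psi (f : A) : A := [ffun y => \sum_x f x * N (x, y)].
have lPsi : linear Psi.
  move=> t f g; apply/ffunP => y; rewrite !ffunE scaler_sumr -big_split.
  by apply: eq_bigr => x _; rewrite !ffunE mulrDl; congr (_ + _); apply/esym/mulrA.
have [|f fa] := galg_surj lPsi _ a.
  move=> f f0; apply/ffunP => x; rewrite [RHS]ffunE; apply: N_nondeg => y.
  by have /ffunP/(_ y) := f0; rewrite !ffunE.
exists (linfun (gpair f)); rewrite -fa; apply/ffunP => y; rewrite !ffunE lfunE.
by apply: eq_bigr => x _; rewrite ffunE mulrC.
Qed.

(** The right contraction is the transpose of the left one, which is onto, so it
is injective, hence onto. *)
Lemma contract_right_surj (a : A) : exists f : 'Hom(A, k^o), contract_right f N = a.
Proof.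
pose Psi (f : A) : A := [ffun x => \sum_y f y * N (x, y)].
have lPsi : linear Psi.
  move=> t f g; apply/ffunP => y; rewrite !ffunE scaler_sumr -big_split.
  by apply: eq_bigr => x _; rewrite !ffunE mulrDl; congr (_ + _); apply/esym/mulrA.
have [|f fa] := galg_surj lPsi _ a.
  move=> f f0; apply/ffunP => z; rewrite [RHS]ffunE.
  have [g /ffunP gz] := contract_left_surj (gelt k z).
  transitivity (\sum_y f y * (gelt k z) y).
    rewrite (bigD1 z) //= big1 => [|y yz]; rewrite ffunE ?eqxx ?mulr1 ?addr0 //.
    by rewrite (negPf yz) mulr0.
  have gE y : gelt k z y = \sum_x N (x, y) * g (gelt k x).
    rewrite -gz ffunE {1}[[ffun x => _]]galgE linear_sum; apply: eq_bigr => x _.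
    by rewrite linearZ /= ffunE.
  rewrite (eq_bigr (fun y => \sum_x g (gelt k x) * (f y * N (x, y)))); last first.
    by move=> y _; rewrite gE mulr_sumr; apply: eq_bigr => x _; rewrite mulrA mulrC.
  rewrite exchange_big big1 // => x _; rewrite -mulr_sumr.
  by have /ffunP/(_ x) := f0; rewrite !ffunE => ->; rewrite mulr0.
exists (linfun (gpair f)); rewrite -fa; apply/ffunP => y; rewrite !ffunE lfunE.
by apply: eq_bigr => x _; rewrite ffunE mulrC.
Qed.

End Contractions.

Lemma galg_lin_expand (k : fieldType) (gT : finGroupType) (U : lmodType k)
    (f : galg k gT -> U) (a : galg k gT) :
  linear f -> f a = \sum_x a x *: f (gelt k x).
Proof.
move=> flin.
pose F : {linear galg k gT -> U} := HB.pack f (GRing.isLinear.Build k _ _ _ f flin).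
rewrite -[f]/(F : _ -> _) {1}[a]galgE linear_sum.
by apply: eq_bigr => x _; rewrite linearZ.
Qed.

Lemma galg_lin_ext (k : fieldType) (gT : finGroupType) (U : lmodType k)
    (f g : galg k gT -> U) :
  linear f -> linear g -> (forall x, f (gelt k x) = g (gelt k x)) -> f =1 g.
Proof.
move=> fl gl fg a; rewrite (galg_lin_expand a fl) (galg_lin_expand a gl).
by apply: eq_bigr => x _; rewrite fg.
Qed.

(** * Structure maps of the tensor powers as linear extensions *)

Section StructureMaps.
Variables (k : fieldType) (gT : finGroupType).
Local Notation A := (galg k gT).
Local Notation A2 := (galg k (prodg gT gT)).
Local Notation A3 := (galg k (prodg (prodg gT gT) gT)).
Local Notation G2 := (prodg gT gT).
Local Notation G3 := (prodg (prodg gT gT) gT).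
Implicit Types (X Y : A2).

(** The group maps underlying the coproduct, the flip, the three legs, and
[D (x) I], [I (x) D]. *)
Definition diagg (x : gT) : G2 := (x, x).
Definition swapg (p : G2) : G2 := (p.2, p.1).
Definition emb12 (p : G2) : G3 := ((p.1, p.2), 1%g).
Definition emb13 (p : G2) : G3 := ((p.1, 1%g), p.2).
Definition emb23 (p : G2) : G3 := ((1%g, p.1), p.2).
Definition dup1 (p : G2) : G3 := ((p.1, p.1), p.2).
Definition dup2 (p : G2) : G3 := ((p.1, p.2), p.2).

Lemma diaggM : {morph diagg : x y / (x * y)%g}. Proof. by []. Qed.
Lemma swapgM : {morph swapg : x y / (x * y)%g}. Proof. by []. Qed.
Lemma dup1M : {morph dup1 : x y / (x * y)%g}. Proof. by []. Qed.
Lemma dup2M : {morph dup2 : x y / (x * y)%g}. Proof. by []. Qed.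
Lemma emb12M : {morph emb12 : x y / (x * y)%g}.
Proof. by move=> x y; congr (_, _); apply/esym/mulg1. Qed.
Lemma emb13M : {morph emb13 : x y / (x * y)%g}.
Proof. by move=> x y; congr (_, _, _); apply/esym/mulg1. Qed.
Lemma emb23M : {morph emb23 : x y / (x * y)%g}.
Proof. by move=> x y; congr (_, _, _); apply/esym/mulg1. Qed.

Lemma tens_gelt x y : tens (gelt k x) (gelt k y) = gelt k ((x, y) : G2).
Proof. by apply/ffunP => -[a b]; rewrite !ffunE xpair_eqE -mulnb natrM. Qed.

Lemma tens11 : tens 1 1 = 1 :> A2. Proof. exact: tens_gelt. Qed.

Lemma comul_groupE (a : A) : comul (group_hopf k gT) a = gpush diagg a.
Proof. by apply: eq_bigr => x _; rewrite tens_gelt. Qed.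

Lemma flipE X : flip X = gpush swapg X.
Proof.
apply: (@galg_lin_ext _ _ _ (@flip k gT) (gpush swapg)); last 1 first.
- case=> a b; rewrite gpush_gelt; apply/ffunP=> -[c d].
  by rewrite !ffunE !xpair_eqE andbC.
- by move=> t Y Z; apply/ffunP => p; rewrite !ffunE.
exact: gpush_is_linear.
Qed.

Lemma leg12E X : leg12 X = gpush emb12 X.
Proof.
apply: (@galg_lin_ext _ _ _ (@leg12 k gT) (gpush emb12)); last 1 first.
- case=> a b; rewrite gpush_gelt; apply/ffunP=> -[[c d] e].
  by rewrite !ffunE [in RHS]xpair_eqE -mulnb natrM.
- by move=> t Y Z; apply/ffunP => p; rewrite !ffunE mulrDl -mulrA.
exact: gpush_is_linear.
Qed.

Lemma leg13E X : leg13 X = gpush emb13 X.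
Proof.
apply: (@galg_lin_ext _ _ _ (@leg13 k gT) (gpush emb13)); last 1 first.
- case=> a b; rewrite gpush_gelt; apply/ffunP=> -[[c d] e].
  by rewrite !ffunE /= !xpair_eqE andbAC -[in RHS]mulnb natrM.
- by move=> t Y Z; apply/ffunP => p; rewrite !ffunE mulrDl -mulrA.
exact: gpush_is_linear.
Qed.

Lemma leg23E X : leg23 X = gpush emb23 X.
Proof.
apply: (@galg_lin_ext _ _ _ (@leg23 k gT) (gpush emb23)); last 1 first.
- case=> a b; rewrite gpush_gelt; apply/ffunP=> -[[c d] e].
  by rewrite !ffunE /= !xpair_eqE -andbA [in RHS]andbC -[in RHS]mulnb natrM.
- by move=> t Y Z; apply/ffunP => p; rewrite !ffunE mulrDl -mulrA.
exact: gpush_is_linear.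
Qed.

Lemma emb12_mulr (X : A2) g c d e :
  (gpush emb12 X * gelt k (((1, 1), g) : G3)%g) (c, d, e) = X (c, d) * (e == g)%:R.
Proof.
rewrite mulr_suml sum_ffunE {2}[X]galgE sum_ffunE mulr_suml.
apply: eq_bigr => -[a b] _; rewrite -scalerAl geltM !ffunE -mulrA; congr (_ * _).
by rewrite !xpair_eqE /= !mulg1 mul1g -mulnb natrM.
Qed.

Lemma emb23_mulr (X : A2) g c d e :
  (gpush emb23 X * gelt k (((g, 1), 1) : G3)%g) (c, d, e) = X (d, e) * (c == g)%:R.
Proof.
rewrite mulr_suml sum_ffunE {2}[X]galgE sum_ffunE mulr_suml.
apply: eq_bigr => -[a b] _; rewrite -scalerAl geltM !ffunE -mulrA; congr (_ * _).
by rewrite !xpair_eqE /= !mulg1 mul1g -andbA andbC -mulnb natrM.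
Qed.

Lemma sandwich_linear (hT lT : finGroupType) (phi : hT -> lT) (K J : galg k lT) :
  linear (fun X : galg k hT => K * gpush phi X * J).
Proof.
by move=> t Y Z; rewrite gpush_is_linear mulrDr mulrDl -scalerAr -scalerAl.
Qed.

Lemma galg_coefP (hT : finGroupType) (t : k) (a b : galg k hT) x :
  (t *: a + b) x = t * a x + b x.
Proof. by rewrite !ffunE. Qed.

Lemma map_leftE (D : A -> A2) X p :
  map_left D X p = D [ffun x => X (x, p.2)] p.1.
Proof. by rewrite ffunE. Qed.

Lemma map_rightE (D : A -> A2) X p :
  map_right D X p = D [ffun y => X (p.1.1, y)] (p.1.2, p.2).
Proof. by rewrite ffunE. Qed.

(** Applying the twisted coproduct to the first leg is conjugation by [J_12] of
the untwisted operation; on a group element [(a, b)] the second leg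
[(1, 1, b)] commutes with [J_12]. *)
Lemma map_left_twisted (J K X : A2) :
  map_left (fun a : A => K * gpush diagg a * J) X =
  gpush emb12 K * gpush dup1 X * gpush emb12 J.
Proof.
move: X; apply: galg_lin_ext.
- move=> t Y Z; apply/ffunP => -[[c d] e]; rewrite galg_coefP !map_leftE /=.
  have -> : [ffun x => (t *: Y + Z) (x, e)] =
      t *: ([ffun x => Y (x, e)] : A) + ([ffun x => Z (x, e)] : A).
    by apply/ffunP => x; rewrite !ffunE.
  by rewrite sandwich_linear galg_coefP.
- exact: sandwich_linear.
case=> a b; rewrite gpush_gelt; have -> : dup1 (a, b) = (emb12 (diagg a) * (1, 1, b))%g.
  by rewrite /dup1 /emb12 /diagg /=; congr (_, _, _); rewrite ?mulg1 ?mul1g.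
rewrite -geltM -mulrA -mulrA.
have -> : gelt k (((1, 1), b) : G3)%g * gpush emb12 J =
          gpush emb12 J * gelt k (((1, 1), b) : G3)%g.
  rewrite mulr_sumr mulr_suml; apply: eq_bigr => -[x y] _.
  rewrite -scalerAl -scalerAr !geltM; congr (_ *: gelt k (_, _, _)).
  - by rewrite mulg1 mul1g.
  - by rewrite mulg1 mul1g.
  - by rewrite mulg1 mul1g.
rewrite 2!mulrA -(gpush_gelt k emb12) -2!(gpush_mul _ _ emb12M).
apply/ffunP => -[[c d] e]; rewrite emb12_mulr map_leftE /=.
have -> : [ffun x => gelt k ((a, b) : G2) (x, e)] = (e == b)%:R *: (gelt k a : A).
  by apply/ffunP => x; rewrite !ffunE xpair_eqE andbC -mulnb natrM.
by rewrite linearZ /= gpush_gelt -scalerAr -scalerAl [LHS]ffunE; apply: mulrC.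
Qed.

Lemma map_right_twisted (J K X : A2) :
  map_right (fun a : A => K * gpush diagg a * J) X =
  gpush emb23 K * gpush dup2 X * gpush emb23 J.
Proof.
move: X; apply: galg_lin_ext.
- move=> t Y Z; apply/ffunP => -[[c d] e]; rewrite galg_coefP !map_rightE /=.
  have -> : [ffun x => (t *: Y + Z) (c, x)] =
      t *: ([ffun x => Y (c, x)] : A) + ([ffun x => Z (c, x)] : A).
    by apply/ffunP => x; rewrite !ffunE.
  by rewrite sandwich_linear galg_coefP.
- exact: sandwich_linear.
case=> a b; rewrite gpush_gelt; have -> : dup2 (a, b) = (emb23 (diagg b) * (a, 1, 1))%g.
  by rewrite /dup1 /emb12 /diagg /=; congr (_, _, _); rewrite ?mulg1 ?mul1g.
rewrite -geltM -mulrA -mulrA.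
have -> : gelt k (((a, 1), 1) : G3)%g * gpush emb23 J =
          gpush emb23 J * gelt k (((a, 1), 1) : G3)%g.
  rewrite mulr_sumr mulr_suml; apply: eq_bigr => -[x y] _.
  rewrite -scalerAl -scalerAr !geltM; congr (_ *: gelt k (_, _, _)).
  - by rewrite mulg1 mul1g.
  - by rewrite mulg1 mul1g.
  - by rewrite mulg1 mul1g.
rewrite 2!mulrA -(gpush_gelt k emb23) -2!(gpush_mul _ _ emb23M).
apply/ffunP => -[[c d] e]; rewrite emb23_mulr map_rightE /=.
have -> : [ffun x => gelt k ((a, b) : G2) (c, x)] = (c == a)%:R *: (gelt k b : A).
  by apply/ffunP => x; rewrite !ffunE xpair_eqE -mulnb natrM.
by rewrite linearZ /= gpush_gelt -scalerAr -scalerAl [LHS]ffunE; apply: mulrC.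
Qed.

Lemma contract_left_counit X :
  contract_left (counit (group_hopf k gT)) X = gpush snd X.
Proof.
apply/ffunP => y; rewrite ffunE gpushE /=.
rewrite (eq_bigr (fun x => X (x, y))) => [|x _]; last by rewrite ffunE.
rewrite [RHS](reindex_onto (fun x => (x, y)) fst) => [|[a b] /= /eqP->] //.
by apply: eq_bigl => x; rewrite /= !eqxx.
Qed.

Lemma contract_right_counit X :
  contract_right (counit (group_hopf k gT)) X = gpush fst X.
Proof.
apply/ffunP => x; rewrite ffunE gpushE /=.
rewrite (eq_bigr (fun y => X (x, y))) => [|y _]; last by rewrite ffunE.
rewrite [RHS](reindex_onto (fun y => (x, y)) snd) => [|[a b] /= /eqP->] //.
by apply: eq_bigl => y; rewrite /= !eqxx.
Qed.

Lemma counit_linear : linear (counit (group_hopf k gT) : A -> k^o).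
Proof.
move=> t a b /=; rewrite scaler_sumr -big_split /=.
by apply: eq_bigr => x _; rewrite !ffunE.
Qed.

Lemma counit_gelt x : counit (group_hopf k gT) (gelt k x) = 1.
Proof.
rewrite /= (bigD1 x) //= big1 => [|y yx]; rewrite ffunE ?eqxx ?addr0 //.
by rewrite (negPf yx).
Qed.

Lemma counitM a b : counit (group_hopf k gT) (a * b) =
  counit (group_hopf k gT) a * counit (group_hopf k gT) b.
Proof.
move: a; apply: (@galg_lin_ext _ _ k^o).
- move=> t x y; rewrite mulrDl -scalerAl; exact: counit_linear.
- by move=> t x y; rewrite counit_linear mulrDl; congr (_ + _); apply/esym/mulrA.
move=> x; move: b; apply: (@galg_lin_ext _ _ k^o).
- move=> t y z; rewrite mulrDr -scalerAr; exact: counit_linear.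
- by move=> t y z; rewrite counit_linear mulrDr; congr (_ + _); apply: mulrCA.
by move=> y; rewrite geltM !counit_gelt mulr1.
Qed.

End StructureMaps.

(** * Twisting a group algebra *)

(** Applied to the twist identity, with the images of [J^-1] as inverses. *)
Lemma mul_eq_inv (R : pzRingType) (a a' b b' c c' d d' : R) :
    a' * a = 1 -> b * b' = 1 -> b' * b = 1 -> c * c' = 1 -> c' * c = 1 ->
    d * d' = 1 ->
  a * b = c * d -> [/\ c' * a = d * b', b' * a' = d' * c' & a' * c = b * d'].
Proof.
move=> a'a bb' b'b cc' c'c dd' e; split; last 1 first.
- by rewrite -[a' * c]mulr1 -dd' -mulrA [c * _]mulrA -e !mulrA a'a mul1r.
  by rewrite -[c' * a]mulr1 -bb' -mulrA [a * _]mulrA e !mulrA c'c mul1r.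
have e1 : b' * a' * (a * b) = 1 by rewrite -mulrA [a' * _]mulrA a'a mul1r.
have e2 : c * d * (d' * c') = 1 by rewrite -mulrA [d * _]mulrA dd' mul1r.
by rewrite -[b' * a']mulr1 -e2 mulrA -e e1 mul1r.
Qed.

(** The computation shared by both hexagon axioms.  For the first one,
[x], [D], [X], [j] are [K_12], [(D (x) I)(K_21)], [(D (x) I)(J)], [J_12]: the
equations are the twist identity and two of its permutations, and [r], [s] are
the legs of the central factor. *)
Lemma hexagon_ring (S : pzRingType) (x D X E j j' a F b c r s : S) :
    (forall z, r * z = z * r) -> (forall z, s * z = z * s) ->
  X * j = E * j' -> x * D = a * F -> F * E = b * c ->
  x * (D * X * (r * s)) * j = a * b * r * (c * j' * s).
Proof.
move=> rC sC e1 e2 e3.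
have rsC z : r * s * z = z * (r * s) by rewrite -mulrA sC mulrA rC -mulrA.
transitivity (x * D * (X * j) * (r * s)).
  by rewrite -!mulrA -[j * _]rsC -!mulrA.
transitivity (a * (b * c) * j' * (r * s)); first by rewrite e1 e2 -e3 !mulrA.
by rewrite -!mulrA [r * (c * _)]rC -!mulrA (rC s).
Qed.

Section Antipode.
Variables (k : fieldType) (gT : finGroupType).
Local Notation A := (galg k gT).
Local Notation G2 := (prodg gT gT).
Local Notation A2 := (galg k G2).
Implicit Types (X Y : A2) (Z : A).

(** [lact X Z = sum S(X_1) Z X_2] and [ract X Z = sum X_1 Z S(X_2)] are actions of
the algebra [A (x) A] on [A], a right and a left one; [lact J 1] and
[ract J^-1 1] are the elements conjugating the antipode. *)
Definition lact X Z : A :=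
  \sum_(p : G2) X p *: (gelt k p.1^-1%g * Z * gelt k p.2).
Definition ract X Z : A :=
  \sum_(p : G2) X p *: (gelt k p.1 * Z * gelt k p.2^-1%g).

Lemma lact_linear Z : linear (lact^~ Z).
Proof.
move=> t X Y; rewrite /lact scaler_sumr -big_split; apply: eq_bigr => p _ /=.
by rewrite galg_coefP scalerDl scalerA.
Qed.
Lemma ract_linear Z : linear (ract^~ Z).
Proof.
move=> t X Y; rewrite /ract scaler_sumr -big_split; apply: eq_bigr => p _ /=.
by rewrite galg_coefP scalerDl scalerA.
Qed.
Lemma lact_linear_r X : linear (lact X).
Proof.
move=> t Y Z; rewrite /lact scaler_sumr -big_split; apply: eq_bigr => p _ /=.
by rewrite mulrDr mulrDl -scalerAr -scalerAl scalerDr !scalerA mulrC.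
Qed.
Lemma ract_linear_r X : linear (ract X).
Proof.
move=> t Y Z; rewrite /ract scaler_sumr -big_split; apply: eq_bigr => p _ /=.
by rewrite mulrDr mulrDl -scalerAr -scalerAl scalerDr !scalerA mulrC.
Qed.

Lemma big_gelt (lT : finGroupType) (U : lmodType k) (F : lT -> U) x :
  \sum_y gelt k x y *: F y = F x.
Proof.
rewrite (bigD1 x) //= big1 => [|y yx]; rewrite ffunE ?eqxx ?scale1r ?addr0 //.
by rewrite (negPf yx) scale0r.
Qed.

Lemma lactM X Y Z : lact (X * Y) Z = lact Y (lact X Z).
Proof.
move: X; apply: galg_lin_ext => [t a b|t a b|p].
- by rewrite mulrDl -scalerAl lact_linear.
- by rewrite lact_linear lact_linear_r.
move: Y; apply: galg_lin_ext => [t a b|t a b|q].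
- by rewrite mulrDr -scalerAr lact_linear.
- by rewrite lact_linear.
by rewrite geltM /lact !big_gelt /= invMg -!geltM !mulrA.
Qed.

Lemma ractM X Y Z : ract (X * Y) Z = ract X (ract Y Z).
Proof.
move: X; apply: galg_lin_ext => [t a b|t a b|p].
- by rewrite mulrDl -scalerAl ract_linear.
- by rewrite ract_linear.
move: Y; apply: galg_lin_ext => [t a b|t a b|q].
- by rewrite mulrDr -scalerAr ract_linear.
- by rewrite ract_linear ract_linear_r.
by rewrite geltM /ract !big_gelt /= invMg -!geltM !mulrA.
Qed.

Lemma lact1 Z : lact 1 Z = Z.
Proof. by rewrite /lact big_gelt /= invg1 [gelt k 1]/(1 : A) mul1r mulr1. Qed.
Lemma ract1 Z : ract 1 Z = Z.
Proof. by rewrite /ract big_gelt /= invg1 [gelt k 1]/(1 : A) mul1r mulr1. Qed.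

(** This and [ract_diagg] are the antipode axioms of the group algebra. *)
Lemma lact_diagg (a : A) : lact (gpush (@diagg gT) a) 1 = counit (group_hopf k gT) a *: 1.
Proof.
move: a; apply: galg_lin_ext => [t a b|t a b|x].
- by rewrite gpush_is_linear lact_linear.
- by rewrite counit_linear scalerDl scalerA.
rewrite gpush_gelt /lact big_gelt counit_gelt scale1r mulr1 geltM /=.
by rewrite mulVg.
Qed.
Lemma ract_diagg (a : A) : ract (gpush (@diagg gT) a) 1 = counit (group_hopf k gT) a *: 1.
Proof.
move: a; apply: galg_lin_ext => [t a b|t a b|x].
- by rewrite gpush_is_linear ract_linear.
- by rewrite counit_linear scalerDl scalerA.
rewrite gpush_gelt /ract big_gelt counit_gelt scale1r mulr1 geltM /=.
by rewrite mulgV.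
Qed.

End Antipode.

Section Twisting.
Variables (k : fieldType) (gT : finGroupType).
Local Notation A := (galg k gT).
Local Notation G2 := (prodg gT gT).
Local Notation G3 := (prodg (prodg gT gT) gT).
Local Notation A2 := (galg k G2).
Local Notation A3 := (galg k G3).

Variables (T : hopf_data k gT) (J K R : A2).
Hypothesis JK : J * K = 1.
Hypothesis twistJ :
  gpush (@dup1 gT) J * gpush (@emb12 gT) J = gpush (@dup2 gT) J * gpush (@emb23 gT) J.
Hypothesis J_fst : gpush fst J = 1 :> A.
Hypothesis J_snd : gpush snd J = 1 :> A.
Hypothesis comulT : forall a, comul T a = K * gpush (@diagg gT) a * J.
Hypothesis counitT : forall a, counit T a = counit (group_hopf k gT) a.
Hypothesis rmatT : rmat T = gpush (@swapg gT) K * J * R.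
Hypothesis R_inv : R * R = 1.
Hypothesis R_central : forall X, R * X = X * R.
Hypothesis R_sym : gpush (@swapg gT) R = R.
Hypothesis R_central13 :
  forall X, gpush (@emb13 gT) R * X = X * gpush (@emb13 gT) R.
Hypothesis R_dup1 : gpush (@dup1 gT) R = gpush (@emb13 gT) R * gpush (@emb23 gT) R.
Hypothesis R_dup2 : gpush (@dup2 gT) R = gpush (@emb13 gT) R * gpush (@emb12 gT) R.
Hypothesis R_central12 :
  forall X, gpush (@emb12 gT) R * X = X * gpush (@emb12 gT) R.
Hypothesis R_central23 :
  forall X, gpush (@emb23 gT) R * X = X * gpush (@emb23 gT) R.

Let KJ : K * J = 1. Proof. exact: galg_unit. Qed.

Lemma push_inv (lT : finGroupType) (phi : G2 -> lT) :
  {morph phi : x y / (x * y)%g} ->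
  gpush phi J * gpush phi K = 1 /\ gpush phi K * gpush phi J = 1.
Proof.
move=> phiM; have phi1 : phi 1%g = 1%g.
  by apply: (mulgI (phi 1%g)); rewrite -phiM !mulg1.
by rewrite -!gpush_mul // JK KJ gpush_1.
Qed.

Lemma twist_perm (s : G3 -> G3) : {morph s : x y / (x * y)%g} ->
  gpush (s \o @dup1 gT) J * gpush (s \o @emb12 gT) J =
  gpush (s \o @dup2 gT) J * gpush (s \o @emb23 gT) J.
Proof.
move=> sM; rewrite -[gpush (s \o @dup1 _) J]gpush_comp.
rewrite -[gpush (s \o @emb12 _) J]gpush_comp.
rewrite -[gpush (s \o @dup2 _) J]gpush_comp -[gpush (s \o @emb23 _) J]gpush_comp.
by rewrite -(gpush_mul _ _ sM) twistJ gpush_mul.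
Qed.

(** With [s] a permutation of the three legs, these are the relations between [J]
and its inverse [K] behind coassociativity, the hexagons and the antipode. *)
Lemma twist_perm_inv (s : G3 -> G3) : {morph s : x y / (x * y)%g} ->
  [/\ gpush (s \o @dup2 gT) K * gpush (s \o @dup1 gT) J =
    gpush (s \o @emb23 gT) J * gpush (s \o @emb12 gT) K,
  gpush (s \o @emb12 gT) K * gpush (s \o @dup1 gT) K =
    gpush (s \o @emb23 gT) K * gpush (s \o @dup2 gT) K &
  gpush (s \o @dup1 gT) K * gpush (s \o @dup2 gT) J =
    gpush (s \o @emb12 gT) J * gpush (s \o @emb23 gT) K].
Proof.
move=> sM.
have cM (phi : G2 -> G3) : {morph phi : x y / (x * y)%g} ->
    {morph s \o phi : x y / (x * y)%g} by move=> pM x y /=; rewrite pM sM.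
have [_ a1] := push_inv (cM _ (@dup1M gT)).
have [c2 c1] := push_inv (cM _ (@dup2M gT)).
have [b1 b2] := push_inv (cM _ (@emb12M gT)).
have [d1' _] := push_inv (cM _ (@emb23M gT)).
exact (mul_eq_inv a1 b1 b2 c2 c1 d1' (twist_perm sM)).
Qed.

Lemma twisted_bialgebra : is_bialgebra T.
Proof.
split.
- split=> [t a b|t a b]; first by rewrite !comulT sandwich_linear.
  by rewrite !counitT counit_linear.
- split=> [|a b]; first by rewrite comulT gpush_1 // mulr1 KJ.
  rewrite !comulT (gpush_mul _ _ (@diaggM gT)) !mulrA; congr (_ * _ * _).
  by rewrite -[_ * J * K]mulrA JK mulr1.
- by split=> [|a b]; rewrite !counitT ?counitM // counit_gelt.
- move=> a; have eL X : map_left (comul T) X = map_left (fun a => K * gpush (@diagg gT) a * J) X.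
    by apply/ffunP=> p; rewrite !map_leftE comulT.
  have eR X : map_right (comul T) X = map_right (fun a => K * gpush (@diagg gT) a * J) X.
    by apply/ffunP=> p; rewrite !map_rightE comulT.
  rewrite eL eR map_left_twisted map_right_twisted comulT.
  rewrite !gpush_mul ?dup1M ?dup2M //.
  rewrite -[LHS]mulrA -[in LHS]mulrA -[RHS]mulrA -[in RHS]mulrA.
  rewrite !gpush_comp !mulrA.
  have [_ e _] := @twist_perm_inv id (fun _ _ => erefl).
  rewrite [X in X * _ * _ * _]e -!mulrA; congr (_ * (_ * (_ * _))).
  exact: twistJ.
have pK (phi : G2 -> gT) : {morph phi : x y / (x * y)%g} -> gpush phi J = 1 ->
    gpush phi K = 1.
  by move=> /push_inv[e _] eJ; rewrite eJ mul1r in e.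
move=> a; rewrite comulT; split.
  have -> : contract_left (counit T) (K * gpush (@diagg gT) a * J) =
      contract_left (counit (group_hopf k gT)) (K * gpush (@diagg gT) a * J).
    by apply/ffunP=> x; rewrite !ffunE counitT.
  rewrite contract_left_counit !gpush_mul //.
  by rewrite J_snd pK // gpush_comp mul1r mulr1 gpush_id.
have -> : contract_right (counit T) (K * gpush (@diagg gT) a * J) =
    contract_right (counit (group_hopf k gT)) (K * gpush (@diagg gT) a * J).
  by apply/ffunP=> x; rewrite !ffunE counitT.
rewrite contract_right_counit !gpush_mul //.
by rewrite J_fst pK // gpush_comp mul1r mulr1 gpush_id.
Qed.

Let Q : A := lact J 1.
Let P : A := ract K 1.

(** Apply [x (x) y (x) z |-> S(x) y S(z)] to [J_12 K_23 = (D (x) I)(K) (I (x) D)(J)]: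
the left side gives [Q P], and on the right [S] cancels the coproducts, leaving
the counits of [J] and [K]. *)
Lemma antipode_unit : Q * P = 1.
Proof.
have [_ _ e] := @twist_perm_inv id (fun _ _ => erefl).
pose th (p : G3) : gT := (p.1.1^-1 * p.1.2 * p.2^-1)%g.
have: gpush th (gpush (@emb12 gT) J * gpush (@emb23 gT) K) =
      gpush th (gpush (@dup1 gT) K * gpush (@dup2 gT) J).
  by congr (gpush _ _); apply/esym.
rewrite !gpush_prod => e1.
transitivity (gpush monoid.inv (gpush fst J) *
              gpush monoid.inv (gpush snd K) : A).
  transitivity (\sum_(x : G2) \sum_(y : G2)
      (J x * K y) *: (gelt k (th (emb12 x * emb23 y)%g) : A)).
    rewrite /Q /P mulr_suml; apply: eq_bigr => p _.
    rewrite mulr_sumr; apply: eq_bigr => q _.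
    rewrite !mulr1 !geltM -scalerAl -scalerAr scalerA geltM; congr (_ *: gelt k _).
    by rewrite /th /= !mulg1 mul1g !mulgA.
  rewrite e1 exchange_big !gpush_comp mulr_suml; apply: eq_bigr => p _.
  rewrite mulr_sumr; apply: eq_bigr => q _.
  rewrite -scalerAl -scalerAr scalerA geltM mulrC; congr (_ *: gelt k _).
  by rewrite /th /= !invMg !mulgA mulgK mulgKV.
have : gpush snd (J * K) = 1 :> A by rewrite JK gpush_1.
rewrite (gpush_mul (phi := snd)) // J_fst J_snd mul1r => ->.
by rewrite !gpush_1 ?invg1 // mul1r.
Qed.

Lemma twisted_antipode : has_antipode T.
Proof.
have PQ : P * Q = 1 by apply: galg_unit antipode_unit.
pose S (a : A) : A := P * gpush monoid.inv a * Q.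
exists S => [t a b|a]; first exact: sandwich_linear.
have mul_map_S_id X : mul_map S id X = P * lact X Q.
  rewrite /mul_map /lact mulr_sumr; apply: eq_bigr => p _.
  by rewrite /S gpush_gelt -scalerAr !mulrA.
have mul_map_id_S X : mul_map id S X = ract X P * Q.
  rewrite /mul_map /ract mulr_suml; apply: eq_bigr => p _.
  by rewrite /S gpush_gelt -scalerAl !mulrA.
rewrite mul_map_S_id mul_map_id_S comulT counitT; split.
  rewrite !lactM -[lact K Q]lactM JK lact1 lact_diagg.
  have := lact_linear_r J (counit (group_hopf k gT) a) 1 0.
  have -> : lact J 0 = 0 :> A.
    by rewrite /lact big1 // => p _; rewrite mulr0 mul0r scaler0.
  by rewrite !addr0 => ->; rewrite -scalerAr PQ.
rewrite !ractM -[ract J P]ractM JK ract1 ract_diagg.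
have := ract_linear_r K (counit (group_hopf k gT) a) 1 0.
have -> : ract K 0 = 0 :> A.
  by rewrite /ract big1 // => p _; rewrite mulr0 mul0r scaler0.
by rewrite !addr0 => ->; rewrite -scalerAl PQ.
Qed.

Lemma twisted_triangular : is_triangular_rmat T.
Proof.
have [JK21 KJ21] := push_inv (@swapgM gT).
have swsw X : gpush (@swapg gT) (gpush (@swapg gT) X) = X.
  by rewrite gpush_comp -[RHS]gpush_id; apply: eq_gpush => -[].
have flipR : flip (rmat T) = K * gpush (@swapg gT) J * R.
  by rewrite flipE rmatT !(gpush_mul _ _ (@swapgM gT)) swsw R_sym.
have RR : flip (rmat T) * rmat T = 1.
  rewrite flipR rmatT -!mulrA R_central -!mulrA R_inv mulr1.
  by rewrite [gpush _ J * _]mulrA JK21 mul1r KJ.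
have eL X : map_left (comul T) X = map_left (fun a => K * gpush (@diagg gT) a * J) X.
  by apply/ffunP=> p; rewrite !map_leftE comulT.
have eR X : map_right (comul T) X = map_right (fun a => K * gpush (@diagg gT) a * J) X.
  by apply/ffunP=> p; rewrite !map_rightE comulT.
split=> //.
- by apply/unitrP; exists (flip (rmat T)); rewrite RR (galg_unit RR).
- move=> a; rewrite comulT flipE rmatT !(gpush_mul _ _ (@swapgM gT)) gpush_comp.
  rewrite -[in LHS]mulrA R_central !mulrA -[_ * J * K]mulrA JK mulr1.
  by rewrite -[_ * gpush _ J * gpush _ K]mulrA JK21 mulr1.
- rewrite eL map_left_twisted rmatT leg13E leg23E.
  rewrite !(gpush_mul _ _ (@dup1M gT)) !(gpush_mul _ _ (@emb13M gT)).
  rewrite !(gpush_mul _ _ (@emb23M gT)).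
  rewrite !gpush_comp R_dup1.
  (* Leg permutations turning the twist identity into the relations for J_(31,2)
     and J_(1,32). *)
  pose s1 (p : G3) : G3 := ((p.1.2, p.2), p.1.1).
  pose s2 (p : G3) : G3 := ((p.1.1, p.2), p.1.2).
  have [//|_ eA _] := @twist_perm_inv s1.
  have [//|_ _ eB] := @twist_perm_inv s2.
  exact (hexagon_ring R_central13 R_central23 twistJ (esym eA) eB).
- rewrite eR map_right_twisted rmatT leg13E leg12E.
  rewrite !(gpush_mul _ _ (@dup2M gT)) !(gpush_mul _ _ (@emb13M gT)).
  rewrite !(gpush_mul _ _ (@emb12M gT)).
  rewrite !gpush_comp R_dup2.
  (* Leg permutations for J_(23,1), and for the exchange of the first two legs. *)
  pose s3 (p : G3) : G3 := ((p.2, p.1.1), p.1.2).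
  pose s4 (p : G3) : G3 := ((p.1.2, p.1.1), p.2).
  have [//|_ eC _] := @twist_perm_inv s3.
  have [//|eD _ _] := @twist_perm_inv s4.
  exact (hexagon_ring R_central13 R_central12 (esym twistJ) eC eD).
Qed.

End Twisting.

(** * The factor R_u *)

Section Bichar.
Variables (k : fieldType) (S : algType k).
Hypothesis two_neq0 : 2%:R != 0 :> k.
Implicit Types a b c : S.

(** [R_u] is the case of two commuting involutions; [bichar] behaves like the sign
pairing of two copies of Z/2, and all properties of [R_u] follow from its
bimultiplicativity. *)
Definition bichar a b : S := 2%:R^-1 *: (1 + b + a - a * b).

Lemma bicharC a b : a * b = b * a -> bichar a b = bichar b a.
Proof. by move=> ab; rewrite /bichar ab [1 + b + a]addrAC. Qed.

Lemma bichar1 b : bichar 1 b = 1.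
Proof.
rewrite /bichar mul1r addrAC addrK -mulr2n -scaler_nat scalerA.
by rewrite mulVf // scale1r.
Qed.

Lemma bicharM a b c : c * c = 1 -> b * c = c * b ->
  bichar (a * b) c = bichar a c * bichar b c.
Proof.
move=> cc bc; pose p := 1 + c; pose m := 1 - c.
(* p / 2 and m / 2 are the idempotents of the eigenvalues 1 and -1 of c. *)
have E x : 1 + c + x - x * c = p + x * m by rewrite mulrBr mulr1 addrA.
have pp : p * p = 2%:R *: p.
  by rewrite /p mulrDl mul1r mulrDr mulr1 cc [c + 1]addrC scaler_nat mulr2n.
have mm : m * m = 2%:R *: m.
  rewrite /m mulrBl mul1r mulrBr mulr1 cc scaler_nat mulr2n; congr (_ + _).
  by rewrite opprB.
have mp : m * p = 0 by rewrite /m /p mulrBl mul1r mulrDr mulr1 cc [c + 1]addrC subrr.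
have pm : p * m = 0 by rewrite /m /p mulrDl mul1r mulrBr mulr1 cc addrA subrK subrr.
have bm : m * b = b * m by rewrite /m mulrBl mulrBr mul1r mulr1 bc.
have pb : p * b = b * p by rewrite /p mulrDl mulrDr mul1r mulr1 bc.
rewrite /bichar; clearbody p m; rewrite !E -scalerAl -scalerAr mulrDl !mulrDr pp.
rewrite -[a * m * p]mulrA mp mulr0 add0r.
rewrite [p * _]mulrA pb -[b * p * m]mulrA pm mulr0 addr0.
rewrite -[a * m * _]mulrA [m * (b * m)]mulrA bm -[b * m * m]mulrA mm.
by rewrite -!scalerAr -scalerDr !scalerA mulfVK // mulrA.
Qed.

End Bichar.

Section RuFacts.
Variables (k : fieldType) (gT : finGroupType) (u : gT).
Hypothesis two_neq0 : 2%:R != 0 :> k.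
Hypothesis uC : u \in 'Z([set: gT])%g.
Hypothesis uu : (u * u = 1)%g.
Local Notation A2 := (galg k (prodg gT gT)).

Lemma u_comm x : (u * x = x * u)%g.
Proof. by have /centerP[_ /(_ x (in_setT x))] := uC. Qed.

Lemma RuE : Ru k u = bichar (gelt k ((u, 1) : prodg gT gT)%g)
                            (gelt k ((1, u) : prodg gT gT)%g).
Proof.
rewrite /Ru /bichar !tens_gelt geltM; congr (_ *: (_ - gelt k (_, _))).
  by rewrite mulg1.
by rewrite mul1g.
Qed.

Lemma gpush_bichar (hT : finGroupType) (phi : prodg gT gT -> hT) a b :
    {morph phi : x y / (x * y)%g} ->
  gpush phi (bichar (gelt k a) (gelt k b)) =
  bichar (gelt k (phi a)) (gelt k (phi b)).
Proof.
move=> phiM; have phi1 : phi 1%g = 1%g.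
  by apply: (mulgI (phi 1%g)); rewrite -phiM !mulg1.
rewrite /bichar linearZ /= linearB !linearD /= (gpush_mul _ _ phiM).
by rewrite gpush_1 // !gpush_gelt.
Qed.

Lemma bichar_central (hT : finGroupType) (a b : hT) :
    (forall x, a * x = x * a)%g -> (forall x, b * x = x * b)%g ->
  forall X, bichar (gelt k a) (gelt k b) * X = X * bichar (gelt k a) (gelt k b).
Proof.
move=> aC bC X.
have gC (c : hT) : (forall x, c * x = x * c)%g -> gelt k c * X = X * gelt k c.
  move=> cC; rewrite {1}[X]galgE {2}[X]galgE mulr_sumr mulr_suml.
  by apply: eq_bigr => x _; rewrite -scalerAr -scalerAl !geltM cC.
rewrite /bichar -scalerAl -scalerAr; congr (_ *: _).
rewrite mulrBl mulrBr !mulrDl !mulrDr mul1r mulr1 !gC //.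
by rewrite -mulrA [in LHS]gC // mulrA gC // mulrA.
Qed.

Let geltMeq (hT : finGroupType) (a b c : hT) : (a * b)%g = c ->
  gelt k a * gelt k b = gelt k c.
Proof. by move=> <-; rewrite geltM. Qed.

Let pair_comm (hT lT : finGroupType) (a c : hT) (b d : lT) :
  (a * c = c * a)%g -> (b * d = d * b)%g ->
  (((a, b) : prodg hT lT) * (c, d) = (c, d) * (a, b) :> prodg hT lT)%g.
Proof. by move=> e1 e2; congr (_, _). Qed.

Let one_comm (hT : finGroupType) (x : hT) : (1 * x = x * 1)%g.
Proof. by rewrite mulg1 mul1g. Qed.

Lemma Ru_central X : Ru k u * X = X * Ru k u.
Proof.
rewrite RuE; apply: bichar_central => -[a b]; apply: pair_comm;
  by [apply: u_comm | apply: one_comm].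
Qed.

Lemma Ru_inv : Ru k u * Ru k u = 1.
Proof.
rewrite RuE -bicharM; last 1 first.
- by rewrite !geltM; congr (gelt k _); apply: pair_comm; rewrite mulg1 mul1g.
- rewrite (geltMeq (c := 1%g)) ?bichar1 //.
  by congr (_, _); rewrite ?uu ?mulg1.
- exact: two_neq0.
by apply: geltMeq; congr (_, _); rewrite ?uu ?mulg1.
Qed.

Lemma Ru_sym : gpush (@swapg gT) (Ru k u) = Ru k u.
Proof.
rewrite RuE gpush_bichar // bicharC // !geltM; congr (gelt k _).
by apply: pair_comm; rewrite mulg1 mul1g.
Qed.

Lemma Ru_central12 X : gpush (@emb12 gT) (Ru k u) * X = X * gpush (@emb12 gT) (Ru k u).
Proof.
rewrite RuE (gpush_bichar _ _ (@emb12M gT)).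
by apply: bichar_central => -[[a b] c]; do 2?[apply: pair_comm];
  by [apply: u_comm | apply: one_comm].
Qed.

Lemma Ru_central13 X : gpush (@emb13 gT) (Ru k u) * X = X * gpush (@emb13 gT) (Ru k u).
Proof.
rewrite RuE (gpush_bichar _ _ (@emb13M gT)).
by apply: bichar_central => -[[a b] c]; do 2?[apply: pair_comm];
  by [apply: u_comm | apply: one_comm].
Qed.

Lemma Ru_central23 X : gpush (@emb23 gT) (Ru k u) * X = X * gpush (@emb23 gT) (Ru k u).
Proof.
rewrite RuE (gpush_bichar _ _ (@emb23M gT)).
by apply: bichar_central => -[[a b] c]; do 2?[apply: pair_comm];
  by [apply: u_comm | apply: one_comm].
Qed.

Lemma Ru_dup1 : gpush (@dup1 gT) (Ru k u) =
  gpush (@emb13 gT) (Ru k u) * gpush (@emb23 gT) (Ru k u).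
Proof.
rewrite RuE (gpush_bichar _ _ (@emb13M gT)) (gpush_bichar _ _ (@emb23M gT)).
rewrite (gpush_bichar _ _ (@dup1M gT)) /emb13 /emb23 /dup1 /=.
rewrite -bicharM //; last 1 first.
- by rewrite !geltM; congr (gelt k (_, _, _)); rewrite ?mulg1 ?mul1g.
- by rewrite (geltMeq (c := (u, u, 1)%g)) //; congr (_, _, _); rewrite ?mulg1 ?mul1g.
by apply: geltMeq; congr (_, _, _); rewrite ?mulg1 ?uu.
Qed.

Lemma Ru_dup2 : gpush (@dup2 gT) (Ru k u) =
  gpush (@emb13 gT) (Ru k u) * gpush (@emb12 gT) (Ru k u).
Proof.
have gC (a b : prodg (prodg gT gT) gT) : (a * b = b * a)%g ->
    gelt k a * gelt k b = gelt k b * gelt k a by move=> e; rewrite !geltM e.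
rewrite RuE (gpush_bichar _ _ (@emb13M gT)) (gpush_bichar _ _ (@emb12M gT)).
rewrite (gpush_bichar _ _ (@dup2M gT)) /emb13 /emb12 /dup2 /=.
rewrite bicharC; last by apply: gC; congr (_, _, _); rewrite ?mulg1 ?mul1g.
rewrite [X in _ = X * _]bicharC; last by apply: gC; congr (_, _, _); rewrite ?mulg1 ?mul1g.
rewrite [X in _ = _ * X]bicharC; last by apply: gC; congr (_, _, _); rewrite ?mulg1 ?mul1g.
rewrite -bicharM //; last 1 first.
- by rewrite !geltM; congr (gelt k (_, _, _)); rewrite ?mulg1 ?mul1g.
- by rewrite (geltMeq (c := (1, u, u)%g)) //; congr (_, _, _); rewrite ?mulg1 ?mul1g.
by apply: geltMeq; congr (_, _, _); rewrite ?mulg1 ?uu.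
Qed.

Lemma twisted_Ru_triangular_hopf (T : hopf_data k gT) (J K : A2) :
    J * K = 1 ->
    gpush (@dup1 gT) J * gpush (@emb12 gT) J = gpush (@dup2 gT) J * gpush (@emb23 gT) J ->
    gpush fst J = 1 :> galg k gT -> gpush snd J = 1 :> galg k gT ->
    (forall a, comul T a = K * gpush (@diagg gT) a * J) ->
    (forall a, counit T a = counit (group_hopf k gT) a) ->
    rmat T = gpush (@swapg gT) K * J * Ru k u ->
  is_triangular_hopf T.
Proof.
move=> JK tw J1 J2 cT eT rT; split.
- exact: (twisted_bialgebra JK tw J1 J2 cT eT).
- exact: (twisted_antipode JK tw J1 J2 cT eT).
exact: (twisted_triangular JK tw cT rT Ru_inv Ru_central Ru_sym Ru_central13
  Ru_dup1 Ru_dup2 Ru_central12 Ru_central23).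
Qed.

End RuFacts.

(** * Matrix algebras whose dual is a regular orbit *)

Section MatrixTwist.
Variables (k : fieldType) (gT : finGroupType) (H : {group gT}) (n : nat).
Variables (r : gT -> 'M[k]_n) (lam : {linear 'M[k]_n -> k^o}).

(** This is a right action of H; the functional [h.lam] is [X |-> lam (rconj X h)]. *)
Definition rconj (X : 'M[k]_n) x : 'M[k]_n := invmx (r x) *m X *m r x.

Hypothesis r_unit : {in H, forall x, r x \in unitmx}.
Hypothesis r_mul : {in H &, forall x y,
  exists2 c : k, c != 0 & r (x * y)%g = c *: (r x *m r y)}.
Hypothesis lam_free : forall t : gT -> k,
  (forall X, \sum_(h in H) t h * lam (rconj X h) = 0) -> {in H, forall h, t h = 0}.
Hypothesis lam_span : forall f : {linear 'M[k]_n -> k^o},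
  exists t : gT -> k, forall X, f X = \sum_(h in H) t h * lam (rconj X h).
Hypothesis lam1 : lam 1%:M = 1.
Hypothesis card_H : #|H| = (n ^ 2)%N.
Hypothesis n_neq0 : n%:R != 0 :> k.

Fact rconj_is_linear x : linear (rconj^~ x).
Proof. by move=> t X Y; rewrite /rconj mulmxDr mulmxDl -scalemxAr -scalemxAl. Qed.
(** [rconj] with its arguments in the order that lets it carry a linear structure. *)
Definition rconj_lin x X := rconj X x.
HB.instance Definition _ x :=
  GRing.isLinear.Build k 'M[k]_n 'M[k]_n _ (rconj_lin x) (rconj_is_linear x).
Lemma rconj_sum x (I : finType) (D : pred I) (F : I -> 'M[k]_n) :
  rconj (\sum_(i | D i) F i) x = \sum_(i | D i) rconj (F i) x.
Proof. exact: (linear_sum (rconj_lin x)). Qed.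
Lemma rconjD x X Y : rconj (X + Y) x = rconj X x + rconj Y x.
Proof. exact: (linearD (rconj_lin x)). Qed.
Lemma rconjB x X Y : rconj (X - Y) x = rconj X x - rconj Y x.
Proof. exact: (linearB (rconj_lin x)). Qed.
Lemma rconjZ x t X : rconj (t *: X) x = t *: rconj X x.
Proof. exact: (linearZ_LR (rconj_lin x)). Qed.

Lemma rconjM x X Y : x \in H -> rconj (X *m Y) x = rconj X x *m rconj Y x.
Proof. by move=> Hx; rewrite /rconj !mulmxA mulmxK ?r_unit. Qed.

Lemma rconj_one x : x \in H -> rconj 1%:M x = 1%:M.
Proof. by move=> Hx; rewrite /rconj mulmx1 mulVmx ?r_unit. Qed.

Lemma rconj_eq x X Y : x \in H -> r x *m Y = X *m r x -> rconj X x = Y.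
Proof. by move=> Hx e; rewrite /rconj -mulmxA -e mulKmx ?r_unit. Qed.

Lemma mul_rconj x X : x \in H -> r x *m rconj X x = X *m r x.
Proof. by move=> Hx; rewrite /rconj -mulmxA mulKVmx ?r_unit. Qed.

Lemma rconj_mulg x y X : x \in H -> y \in H -> rconj X (x * y)%g = rconj (rconj X x) y.
Proof.
move=> Hx Hy; have [c c0 e] := r_mul Hx Hy.
apply: rconj_eq; first exact: groupM.
rewrite e -scalemxAl -scalemxAr -mulmxA mul_rconj // mulmxA mul_rconj //.
by rewrite mulmxA.
Qed.

Lemma rconj_inj x : x \in H -> injective (rconj^~ x).
Proof.
move=> Hx X Y e; have := mul_rconj X Hx; rewrite e mul_rconj // => e2.
by rewrite -[X](mulmxK (r_unit Hx)) -e2 mulmxK ?r_unit.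
Qed.

Lemma rconj1 X : rconj X 1%g = X.
Proof. by apply: (rconj_inj (group1 H)); rewrite -rconj_mulg ?mulg1. Qed.

Lemma rconjK x X : x \in H -> rconj (rconj X x) x^-1%g = X.
Proof. by move=> Hx; rewrite -rconj_mulg ?groupV // mulgV rconj1. Qed.

Lemma mxtrace_rconj x X : x \in H -> \tr (rconj X x) = \tr X.
Proof. by move=> Hx; rewrite /rconj -mulmxA mxtrace_mulC mulmxK ?r_unit. Qed.

Lemma lam_sep X : (forall h, h \in H -> lam (rconj X h) = 0) -> X = 0.
Proof.
move=> X0; apply/matrixP => i j; rewrite mxE.
pose f (Y : 'M[k]_n) : k^o := Y i j.
have fl : linear f by move=> t Y Z; rewrite /f !mxE.
pose F : {linear 'M[k]_n -> k^o} := HB.pack f (GRing.isLinear.Build k _ _ _ f fl).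
have [t /(_ X)] := lam_span F; rewrite big1 => [//|h Hh].
by rewrite X0 ?mulr0.
Qed.

Definition tau (X : 'M[k]_n) : k := n%:R * \tr X.

(** The sum is H-invariant, and an invariant [T] is the scalar [lam T], as all
[h.lam] agree on both.  The scalar is then found by taking traces, with
|H| = n^2. *)
Lemma twirl X : \sum_(h in H) rconj X h = (tau X)%:M.
Proof.
set T := \sum_(h in H) _.
have Tg g : g \in H -> rconj T g = T.
  move=> Hg; rewrite rconj_sum [RHS](reindex_inj (mulIg g)) /=.
  apply: eq_big => [h|h Hh]; first by rewrite groupMr.
  by rewrite rconj_mulg.
have TE : T = (lam T)%:M.
  apply/eqP; rewrite -subr_eq0; apply/eqP/lam_sep => g Hg.
  rewrite rconjB Tg // -scalemx1 rconjZ rconj_one // linearB linearZ /= lam1.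
  by apply/eqP; rewrite subr_eq0 eq_sym; apply/eqP/mulr1.
rewrite TE; congr (_%:M); have := congr1 mxtrace TE.
rewrite mxtrace_scalar linear_sum (eq_bigr (fun=> \tr X)) => [|h Hh]; last first.
  exact: mxtrace_rconj.
rewrite sumr_const card_H expnS expn1 mulrnA.
rewrite -[_ *+ n *+ n]mulr_natr -[lam T *+ n]mulr_natr => e.
by rewrite /tau mulr_natl; apply/esym/(mulIf n_neq0).
Qed.

Fact tau_is_linear : linear (tau : 'M[k]_n -> k^o).
Proof. by move=> t X Y; rewrite /tau linearP mulrDr /= [in LHS]mulrCA. Qed.
HB.instance Definition _ :=
  GRing.isLinear.Build k 'M[k]_n k^o _ (tau : 'M[k]_n -> k^o) tau_is_linear.

Lemma tau_rconj x X : x \in H -> tau (rconj X x) = tau X.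
Proof. by move=> Hx; rewrite /tau mxtrace_rconj. Qed.

Lemma tauC (X Y : 'M[k]_n) : tau (X *m Y) = tau (Y *m X).
Proof. by rewrite /tau mxtrace_mulC. Qed.

Lemma tau_delta (X : 'M[k]_n) i j : tau (X *m (delta_mx i j : 'M[k]_n)) = n%:R * X j i.
Proof.
rewrite /tau; congr (_ * _); rewrite /mxtrace (bigD1 j) //= big1 ?addr0.
  rewrite mxE (bigD1 i) //= big1 ?addr0 ?mxE ?eqxx ?mulr1 // => l li.
  by rewrite mxE (negPf li) mulr0.
move=> m mj; rewrite mxE big1 // => l _.
by rewrite mxE (negPf mj) andbF mulr0.
Qed.

Lemma tau_nondeg (X : 'M[k]_n) : (forall Y : 'M[k]_n, tau (X *m Y) = 0) -> X = 0.
Proof.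
move=> X0; apply/matrixP => i j; rewrite mxE.
by apply: (mulfI n_neq0); rewrite -tau_delta X0 mulr0.
Qed.

Lemma tau_dual : exists L : 'M[k]_n, forall X, lam X = tau (X *m L).
Proof.
pose c (j i : 'I_n) : k := lam (delta_mx j i).
exists (\matrix_(i < n, j < n) (n%:R^-1 * c j i)) => X.
rewrite {1}[X]matrix_sum_delta linear_sum /tau mulr_sumr; apply: eq_bigr => i _.
rewrite linear_sum mxE mulr_sumr; apply: eq_bigr => j _.
by rewrite linearZ /= mxE [RHS]mulrCA mulrA -mulrA mulVKf.
Qed.

Variable L : 'M[k]_n.
Hypothesis lamL : forall X, lam X = tau (X *m L).

Lemma lam_rconj h X : h \in H -> lam (rconj X h) = tau (X *m rconj L h^-1%g).
Proof.
move=> Hh; rewrite lamL -(tau_rconj _ (groupVr Hh)) rconjM ?groupV //.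
by rewrite rconjK.
Qed.

(** The [L^h] represent, through [tau], the functionals [h^-1.lam]. *)
Lemma L_free (t : gT -> k) : \sum_(h in H) t h *: rconj L h = 0 ->
  {in H, forall h, t h = 0}.
Proof.
move=> t0 h Hh; rewrite -[h]invgK.
apply: (lam_free (t := fun x => t x^-1%g)); last by rewrite groupV.
move=> X; transitivity (tau (X *m \sum_(h in H) t h *: rconj L h)); last first.
  by rewrite t0 mulmx0 linear0.
rewrite mulmx_sumr linear_sum (reindex_inj invg_inj) /=.
apply: eq_big => [x|x Hx]; first by rewrite groupV.
rewrite groupV in Hx.
by rewrite invgK lam_rconj ?groupV // invgK -scalemxAr linearZ.
Qed.

(** Multiply the hypothesis at [r g] by [r(g)^-1 W] and sum over [g]: twirling
leaves [sum_h tau(W A^h) L^h = 0]. *)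
Lemma twisted_sum_eq0 A :
  (forall W, \sum_(h in H) rconj A h *m W *m rconj L h = 0) -> A = 0.
Proof.
move=> A0; apply: tau_nondeg => W; rewrite tauC -[A]rconj1.
apply: (L_free (t := fun h => tau (W *m rconj A h))); last exact: group1.
transitivity (\sum_(h in H) \sum_(g in H) rconj (W *m rconj A h) g *m rconj L h).
  by apply: eq_bigr => h _; rewrite -mulmx_suml twirl mul_scalar_mx.
rewrite exchange_big big1 // => g Hg /=.
transitivity (invmx (r g) *m W *m \sum_(h in H) rconj A h *m r g *m rconj L h).
  by rewrite mulmx_sumr; apply: eq_bigr => h _; rewrite {1}/rconj !mulmxA.
by rewrite A0 mulmx0.
Qed.

(** The bilinear form on M given by [J_21^-1 J], see [twist_inverse]. *)
Definition beta A B := \sum_(h in H) lam (rconj A h *m B *m rconj L h).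

Definition sandw X Y W := \sum_(h in H) rconj X h *m W *m rconj Y h.

Fact sandw_is_linear X Y : linear (sandw X Y).
Proof.
move=> t W Z; rewrite /sandw scaler_sumr -big_split; apply: eq_bigr => h _ /=.
by rewrite mulmxDr mulmxDl -scalemxAr -scalemxAl.
Qed.
HB.instance Definition _ X Y :=
  GRing.isLinear.Build k 'M[k]_n 'M[k]_n _ (sandw X Y) (sandw_is_linear X Y).

Lemma rconj_sandw X Y W g : g \in H -> rconj (sandw X Y W) g = sandw X Y (rconj W g).
Proof.
move=> Hg; rewrite /sandw rconj_sum [RHS](reindex_inj (mulIg g)) /=.
apply: eq_big => [h|h Hh]; first by rewrite groupMr.
by rewrite rconjM // [X in X *m _]rconjM // !rconj_mulg.
Qed.

Lemma tau_sandw X Y Z W : tau (sandw X Y Z *m W) = tau (Z *m sandw Y X W).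
Proof.
rewrite /sandw mulmx_suml mulmx_sumr !linear_sum; apply: eq_bigr => h _ /=.
by move: (rconj X h) (rconj Y h) => x y; rewrite -!mulmxA tauC -!mulmxA.
Qed.

Lemma betaE A B : beta A B = tau (B *m sandw L A L).
Proof.
rewrite /beta /sandw mulmx_sumr linear_sum; apply: eq_bigr => h _ /=.
by move: (rconj A h) (rconj L h) => x y; rewrite lamL -!mulmxA tauC -!mulmxA.
Qed.

Section CentralInvolution.
Variable u : gT.
Hypothesis Hu : u \in H.
Hypothesis uC : {in H, forall h, u * h = h * u}%g.
Hypothesis uu : (u * u = 1)%g.
Hypothesis two_neq0 : 2%:R != 0 :> k.

Lemma rconj_uu X : rconj (rconj X u) u = X.
Proof. by rewrite -rconj_mulg // uu rconj1. Qed.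

Lemma tau_rconj_u X Y : tau (rconj X u *m Y) = tau (X *m rconj Y u).
Proof. by rewrite -(tau_rconj _ Hu) rconjM // rconj_uu. Qed.

Lemma sandw_rconj_u A B W : sandw (rconj A u) B W = invmx (r u) *m sandw A B (r u *m W).
Proof.
rewrite /sandw mulmx_sumr; apply: eq_bigr => h Hh.
by rewrite -rconj_mulg // uC // rconj_mulg // {1}/rconj !mulmxA.
Qed.

(** Twice the action of [R_u] on the pair [(A, W)], when [F] depends linearly on
[A] and [G] is [F] for [A^u]. *)
Let usym (F G : 'M[k]_n -> 'M[k]_n) W := F W + F (rconj W u) + G W - G (rconj W u).

(** [G] is equivariant and vanishes at [L], hence on all [L^g], which span M; so
its adjoint [G'] vanishes.  [G'] involves the twisted sum of [A] on the part
fixed by [u] and that of [A^u] on the part negated by [u]; the latter reduces to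
[A] as well, because [u] acts on M by the inner automorphism of [r u]. *)
Lemma beta_Ru_nondeg A :
  (forall B, beta A B + beta A (rconj B u) + beta (rconj A u) B
             - beta (rconj A u) (rconj B u) = 0) -> A = 0.
Proof.
move=> A0; pose G := usym (sandw L A) (sandw L (rconj A u)).
have GL : G L = 0.
  apply: tau_nondeg => B; rewrite tauC /G /usym mulmxBr !mulmxDr linearB !linearD /=.
  by rewrite -!(rconj_sandw _ _ _ Hu) -!tau_rconj_u -!betaE A0.
have GLg g : g \in H -> G (rconj L g) = 0.
  move=> Hg; transitivity (rconj (G L) g); last by rewrite GL /rconj mulmx0 mul0mx.
  by rewrite /G /usym rconjB !rconjD !rconj_sandw // -!rconj_mulg // uC.
pose G' := usym (sandw A L) (sandw (rconj A u) L).
have G'0 W : G' W = 0.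
  apply: lam_sep => g Hg; rewrite lam_rconj // tauC.
  rewrite -[RHS](linear0 tau) -(mul0mx _ W) -(GLg _ (groupVr Hg)).
  rewrite /G /G' /usym !(mulmxBl, mulmxBr, mulmxDl, mulmxDr, linearB, linearD) /=.
  by rewrite !tau_sandw !tau_rconj_u !rconj_sandw.
have S1 W : sandw A L (W + rconj W u) = 0.
  have := G'0 (W + rconj W u); rewrite /G' /usym rconjD rconj_uu [rconj W u + W]addrC addrK.
  by rewrite -mulr2n -scaler_nat => /eqP; rewrite scaler_eq0 (negPf two_neq0) => /eqP.
have S2 W : sandw (rconj A u) L (W - rconj W u) = 0.
  have := G'0 W; rewrite /G' /usym; have := S1 W; rewrite linearD => ->.
  rewrite add0r => e.
  by rewrite linearB.
have S3 W : sandw A L (W - rconj W u) = 0.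
  have := congr1 (mulmx (r u)) (S2 (invmx (r u) *m W)).
  rewrite sandw_rconj_u mulmx0 mulKVmx ?r_unit // mulmxBr mulKVmx ?r_unit //.
  by rewrite mul_rconj.
apply: twisted_sum_eq0 => W.
have : sandw A L (2%:R *: W) = 0.
  have -> : 2%:R *: W = (W + rconj W u) + (W - rconj W u).
    by rewrite addrACA subrr addr0 scaler_nat mulr2n.
  by rewrite linearD /= S1 S3 addr0.
by rewrite linearZ /= => /eqP; rewrite scaler_eq0 (negPf two_neq0) => /eqP.
Qed.

End CentralInvolution.

(** * The twist of a regular orbit and its inverse *)

Hypothesis two_neq0 : 2%:R != 0 :> k.
Variable gamma : gT -> gT -> k.
Hypothesis gammaP : forall X Y : 'M[k]_n, lam (X *m Y) =
  \sum_(a in H) \sum_(b in H) gamma a b * (lam (rconj X a) * lam (rconj Y b)).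

Local Notation A := (galg k gT).
Local Notation G2 := (prodg gT gT).
Local Notation G3 := (prodg (prodg gT gT) gT).
Local Notation A2 := (galg k G2).
Local Notation A3 := (galg k G3).
Local Notation HH := [group of setX H H].
Local Notation HHH := [group of setX HH H].

Lemma inHH (p : G2) : (p \in HH) = (p.1 \in H) && (p.2 \in H).
Proof. by rewrite inE. Qed.

Lemma inHHH (p : G3) :
  (p \in HHH) = [&& p.1.1 \in H, p.1.2 \in H & p.2 \in H].
Proof. by rewrite inE /= inHH andbA. Qed.

(** Extended by zero so that sums over the whole group can be used. *)
Definition lamH (X : 'M[k]_n) x : k := if x \in H then lam (rconj X x) else 0.
Definition lamH2 X Y (p : G2) : k := lamH X p.1 * lamH Y p.2.
Definition lamH3 X Y Z (p : G3) : k := lamH2 X Y p.1 * lamH Z p.2.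

Lemma lamHM X x y : x \in H -> lamH X (x * y)%g = lamH (rconj X x) y.
Proof. by move=> Hx; rewrite /lamH groupMl //; case: ifP => // Hy; rewrite rconj_mulg. Qed.

Lemma lamH_one x : x \in H -> lamH 1%:M x = 1.
Proof. by move=> Hx; rewrite /lamH Hx rconj_one. Qed.

Lemma lamH1 X : lamH X 1%g = lam X.
Proof. by rewrite /lamH group1 rconj1. Qed.

Lemma lamH_free (t : gT -> k) : (forall X, \sum_x t x * lamH X x = 0) ->
  {in H, forall x, t x = 0}.
Proof.
move=> t0; apply: lam_free => X; rewrite -[RHS](t0 X) [RHS](bigID (mem H)) /=.
rewrite [X in _ = _ + X]big1 ?addr0 => [|x /negPf xH]; last by rewrite /lamH xH mulr0.
by apply: eq_bigr => x Hx; rewrite /lamH Hx.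
Qed.

Lemma lamH_inj (S T : A) : supported H S -> supported H T ->
  (forall X, gpair (lamH X) S = gpair (lamH X) T) -> S = T.
Proof.
move=> Ss Ts e; apply/eqP; rewrite -subr_eq0; apply/eqP/ffunP => x.
rewrite [RHS]ffunE; have [Hx|xH] := boolP (x \in H); last first.
  by rewrite ffunE [X in _ + X]ffunE Ss // Ts // subr0.
apply: (lamH_free (t := S - T)) Hx => X.
by rewrite -[LHS]/(gpair (lamH X) (S - T)) linearB /= e subrr.
Qed.

Lemma gpair_lamH (hT : finGroupType) (F : hT -> k) (X : galg k (prodg hT gT)) Y :
  gpair (fun p => F p.1 * lamH Y p.2) X = \sum_x (\sum_y X (x, y) * lamH Y y) * F x.
Proof.
transitivity (\sum_x \sum_y X (x, y) * (F x * lamH Y y)).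
  by rewrite pair_bigA; apply: eq_bigr => -[].
apply: eq_bigr => x _; rewrite mulr_suml; apply: eq_bigr => y _.
by rewrite mulrA mulrAC.
Qed.

Lemma lamH2_inj (S T : A2) : supported HH S -> supported HH T ->
  (forall X Y, gpair (lamH2 X Y) S = gpair (lamH2 X Y) T) -> S = T.
Proof.
move=> Ss Ts e; apply/eqP; rewrite -subr_eq0; apply/eqP/ffunP => -[x y].
rewrite [RHS]ffunE; have [xy|xy] := boolP ((x, y) \in HH); last first.
  by rewrite ffunE [X in _ + X]ffunE Ss // Ts // subr0.
move: xy; rewrite in_setX /= => /andP[Hx Hy].
apply: (lamH_free (t := fun y => (S - T) (x, y))) Hy => Y.
apply: (lamH_free (t := fun x => \sum_y (S - T) (x, y) * lamH Y y)) Hx => X.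
rewrite -(@gpair_lamH _ (lamH X)) linearB /=.
by apply/eqP; rewrite subr_eq0; apply/eqP/e.
Qed.

Lemma lamH3_inj (S T : A3) : supported HHH S -> supported HHH T ->
  (forall X Y Z, gpair (lamH3 X Y Z) S = gpair (lamH3 X Y Z) T) -> S = T.
Proof.
move=> Ss Ts e; apply/eqP; rewrite -subr_eq0; apply/eqP/ffunP => -[q z].
rewrite [RHS]ffunE; have [qz|qz] := boolP ((q, z) \in HHH); last first.
  by rewrite ffunE [X in _ + X]ffunE Ss // Ts // subr0.
move: qz; rewrite in_setX /= => /andP[Hq Hz].
apply: (lamH_free (t := fun y => (S - T) (q, y))) Hz => Z.
pose U : A2 := [ffun q => \sum_z (S - T) (q, z) * lamH Z z].
have -> : \sum_z (S - T) (q, z) * lamH Z z = U q by rewrite ffunE.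
have UH : supported HH U.
  move=> p pH; rewrite ffunE big1 // => x _.
  have pxH : (p, x) \notin HHH by rewrite in_setX negb_and pH.
  by rewrite ffunE [X in _ + X]ffunE Ss // Ts // subr0 mul0r.
suff -> : U = 0 by rewrite ffunE.
apply: lamH2_inj => // [p _|X Y]; first by rewrite ffunE.
rewrite linear0; transitivity (gpair (lamH3 X Y Z) (S - T)); last first.
  by rewrite linearB /= e subrr.
by rewrite /lamH3 gpair_lamH; apply: eq_bigr => p _; rewrite ffunE.
Qed.

Let J : A2 := proj_twist H gamma.

Lemma gpair_twist phi :
  gpair phi J = \sum_(a in H) \sum_(b in H) gamma a b * phi (a, b).
Proof.
rewrite linear_sum; apply: eq_bigr => a _; rewrite linear_sum.
by apply: eq_bigr => b _; rewrite linearZ /= tens_gelt gpair_gelt.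
Qed.

Lemma twist_supp : supported HH J.
Proof.
move=> [a b]; rewrite in_setX /= => abH.
rewrite sum_ffunE big1 // => x Hx; rewrite sum_ffunE big1 // => y Hy.
rewrite tens_gelt !ffunE (_ : (_ == _) = false) ?scaler0 //; last first.
  by apply: contraNF abH; rewrite xpair_eqE => /andP[/eqP-> /eqP->]; apply/andP.
Qed.

(** Translates of the defining property of [J] by [H x H]. *)
Lemma twist_lamH X Y x y : x \in H -> y \in H ->
  \sum_(q : G2) J q * (lamH X (x * q.1)%g * lamH Y (y * q.2)%g) =
  lam (rconj X x *m rconj Y y).
Proof.
move=> Hx Hy; rewrite -[LHS]/(gpair (fun q : G2 => lamH X (x * q.1)%g * lamH Y (y * q.2)%g) J).
rewrite gpair_twist gammaP; apply: eq_bigr => a Ha; apply: eq_bigr => b Hb.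
by rewrite !lamHM // /lamH Ha Hb.
Qed.

Lemma lamH2_mul_twist X Y (S : A2) : supported HH S ->
  gpair (lamH2 X Y) (S * J) = \sum_(p : G2) S p * lam (rconj X p.1 *m rconj Y p.2).
Proof.
move=> SH; rewrite gpairM; apply: eq_bigr => p _.
have [->|/(supportedP SH)] := eqVneq (S p) 0; first by rewrite !mul0r.
by rewrite inHH => /andP[Hx Hy]; rewrite twist_lamH.
Qed.

Lemma lamH2_twist X Y : gpair (lamH2 X Y) J = lam (X *m Y).
Proof.
rewrite gpair_twist gammaP; apply: eq_bigr => a Ha; apply: eq_bigr => b Hb.
by rewrite /lamH2 /lamH /= Ha Hb.
Qed.

Lemma twist_fst : gpush fst J = 1 :> A.
Proof.
apply: lamH_inj => [||X]; last 1 first.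
- rewrite gpair_gpush [RHS]gpair_gelt lamH1 -[X in lam X]mulmx1 -lamH2_twist.
  apply: eq_gpair => p /(supportedP twist_supp); rewrite inHH => /andP[_ Hy].
  by rewrite /lamH2 lamH_one // mulr1.
- by apply: supported_gpush twist_supp => p; rewrite inHH => /andP[].
exact: supported1.
Qed.

Lemma twist_snd : gpush snd J = 1 :> A.
Proof.
apply: lamH_inj => [||X]; last 1 first.
- rewrite gpair_gpush [RHS]gpair_gelt lamH1 -[X in lam X]mul1mx -lamH2_twist.
  apply: eq_gpair => p /(supportedP twist_supp); rewrite inHH => /andP[Hx _].
  by rewrite /lamH2 lamH_one // mul1r.
- by apply: supported_gpush twist_supp => p; rewrite inHH => /andP[].
exact: supported1.
Qed.

(** Both sides pair with [X], [Y], [Z] to [lam (X Y Z)]. *)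
Lemma twist_twist :
  gpush (@dup1 gT) J * gpush (@emb12 gT) J = gpush (@dup2 gT) J * gpush (@emb23 gT) J.
Proof.
have suppP (f : G2 -> G3) : (forall p, p \in HH -> f p \in HHH) ->
    supported HHH (gpush f J) by move=> fH; apply: supported_gpush twist_supp.
apply: lamH3_inj => [||X Y Z].
- apply: supportedM; apply: suppP => p; rewrite inHH inHHH /= => /andP[Ha Hb];
    by rewrite ?Ha ?Hb ?group1.
- apply: supportedM; apply: suppP => p; rewrite inHH inHHH /= => /andP[Ha Hb];
    by rewrite ?Ha ?Hb ?group1.
transitivity (lam (X *m Y *m Z)).
  rewrite gpairM -[LHS]/(gpair (fun x => \sum_y _ ) _) gpair_gpush gpair_twist.
  rewrite gammaP; apply: eq_bigr => a Ha; apply: eq_bigr => b Hb; congr (_ * _).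
  rewrite /= -[LHS]/(gpair (fun y => lamH3 X Y Z (dup1 (a, b) * y)%g) _) gpair_gpush.
  rewrite rconjM // -twist_lamH // mulr_suml; apply: eq_bigr => q _.
  have oZ : lamH Z b = lam (rconj Z b) by rewrite /lamH Hb.
  by rewrite /= /lamH3 /lamH2 /= mulg1 oZ !mulrA.
rewrite -mulmxA gpairM -[RHS]/(gpair (fun x => \sum_y _ ) _) gpair_gpush gpair_twist.
rewrite gammaP; apply: eq_bigr => a Ha; apply: eq_bigr => b Hb; congr (_ * _).
rewrite /= -[RHS]/(gpair (fun y => lamH3 X Y Z (dup2 (a, b) * y)%g) _) gpair_gpush.
rewrite rconjM // -twist_lamH // mulr_sumr; apply: eq_bigr => q _.
have oX : lamH X a = lam (rconj X a) by rewrite /lamH Ha.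
by rewrite /= /lamH3 /lamH2 /= mulg1 oX -!mulrA mulrCA.
Qed.

(** [K] is read off from [lam(X) lam(Y) = sum_h lam(X Y^h L^h)] after expanding
[lam(Z L^h)] in the [y.lam]; its flip times [J] then pairs to [beta]. *)
Lemma twist_inverse : exists K : A2,
  [/\ supported HH K, K * J = 1 &
      forall X Y, gpair (lamH2 X Y) (gpush (@swapg gT) K * J) = beta X Y].
Proof.
have [mu muP] : exists mu : gT -> gT -> k, forall h, forall Z,
    lam (Z *m rconj L h) = \sum_(y in H) mu h y * lam (rconj Z y).
  apply: (fin_all_exists (P := fun h (t : gT -> k) => forall Z,
    lam (Z *m rconj L h) = \sum_(y in H) t y * lam (rconj Z y))) => h.
  pose f (Z : 'M[k]_n) : k^o := lam (Z *m rconj L h).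
  have fl : linear f by move=> t X Y; rewrite /f mulmxDl -scalemxAl linearP.
  exact: (lam_span (HB.pack f (GRing.isLinear.Build k _ _ _ f fl))).
pose K : A2 := \sum_(h in H) \sum_(y in H) mu h y *: gelt k (y, (h * y)%g).
have KH : supported HH K.
  move=> p pH; rewrite sum_ffunE big1 // => h Hh; rewrite sum_ffunE big1 // => y Hy.
  rewrite !ffunE (_ : (_ == _) = false) ?scaler0 ?mulr0 //.
  by apply: contraNF pH => /eqP->; rewrite inHH /= groupM ?Hy.
have pairK phi : gpair phi K = \sum_(h in H) \sum_(y in H) mu h y * phi (y, (h * y)%g).
  rewrite linear_sum; apply: eq_bigr => a _; rewrite linear_sum.
  by apply: eq_bigr => b _; rewrite linearZ /= gpair_gelt.
exists K; split=> // [|X Y].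
  apply: lamH2_inj => [||X Y].
  - by apply: supportedM => //; apply: twist_supp.
  - exact: supported1.
  rewrite lamH2_mul_twist // [RHS]gpair_gelt /lamH2 /= !lamH1.
  rewrite [LHS](pairK (fun p => lam (rconj X p.1 *m rconj Y p.2))) /=.
  transitivity (\sum_(h in H) lam (X *m rconj Y h *m rconj L h)).
    apply: eq_bigr => h Hh; rewrite muP; apply: eq_bigr => y Hy.
    by rewrite rconjM // rconj_mulg.
  rewrite -linear_sum (eq_bigr (fun h => X *m rconj (Y *m L) h)); last first.
    by move=> h Hh; rewrite rconjM // mulmxA.
  by rewrite -mulmx_sumr twirl mul_mx_scalar linearZ /= -lamL mulrC.
have sKH : supported HH (gpush (@swapg gT) K).
  by apply: supported_gpush KH => p; rewrite !inHH andbC.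
rewrite lamH2_mul_twist //.
rewrite -[LHS]/(gpair (fun p : G2 => lam (rconj X p.1 *m rconj Y p.2)) _) gpair_gpush.
rewrite [LHS]pairK /=.
apply: eq_bigr => h Hh; rewrite muP; apply: eq_bigr => y Hy.
by rewrite rconjM // rconj_mulg.
Qed.

(** [X |-> (h |-> lam(X^h))] is onto the functions on [H]: by [lam_free] no
nonzero functional annihilates its image. *)
Lemma lamH_onto (t : gT -> k) : exists X, {in H, forall x, lam (rconj X x) = t x}.
Proof.
pose c (i : 'I_(n * n)) x : k := lam (rconj (vec_mx (delta_mx 0 i)) x).
pose Phi := \matrix_(i < n * n, j < #|H|) c i (enum_val j).
have PhiE (w : 'rV_(n * n)) j : (w *m Phi) 0 j = lam (rconj (vec_mx w) (enum_val j)).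
  rewrite mxE {2}[w]row_sum_delta linear_sum rconj_sum linear_sum.
  by apply: eq_bigr => i _; rewrite mxE linearZ /= rconjZ linearZ.
have full : row_full Phi.
  rewrite -cokermx_eq0; apply/eqP/matrixP => j l; rewrite [RHS]mxE.
  pose s x := cokermx Phi (enum_rank_in (group1 H) x) l.
  suff s0 : {in H, forall x, s x = 0}.
    by have := s0 _ (enum_valP j); rewrite /s enum_valK_in.
  apply: lam_free => X; have := congr1 (fun M => (mxvec X *m M) 0 l) (mulmx_coker Phi).
  rewrite mulmx0 mulmxA mxE [RHS]mxE => e; rewrite -[RHS]e big_enum_val.
  by apply: eq_bigr => i _; rewrite PhiE mxvecK mulrC /s enum_valK_in.
have /submxP[w ew] := submx_full (\row_(j < #|H|) t (enum_val j)) full.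
exists (vec_mx w) => x Hx.
by have := PhiE w (enum_rank_in (group1 H) x); rewrite -ew mxE enum_rankK_in.
Qed.

(** * Nondegeneracy of J_21^-1 J R_u *)

Section Nondeg.
Variables (R : A2) (u : gT).
Hypothesis R_supp : supported HH R.
Hypothesis R_beta : forall X Y, gpair (lamH2 X Y) R = beta X Y.

Lemma gpair_Ru (v : gT) (psi : G2 -> k) :
  gpair psi (Ru k v) =
  2%:R^-1 * (psi (1, 1) + psi (1, v) + psi (v, 1) - psi (v, v))%g.
Proof.
by rewrite /Ru !tens_gelt linearZ linearB !linearD /= !gpair_gelt.
Qed.

Lemma R_Ru_beta (v : gT) X Y : v \in H -> (forall x, v * x = x * v)%g ->
  gpair (lamH2 X Y) (R * Ru k v) =
  2%:R^-1 * (beta X Y + beta X (rconj Y v) + beta (rconj X v) Y - beta (rconj X v) (rconj Y v)).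
Proof.
move=> Hv vC; have lamH_v Z x : lamH Z (x * v)%g = lamH (rconj Z v) x.
  by rewrite -vC lamHM.
rewrite gpairM -!R_beta /gpair -!big_split -sumrB mulr_sumr /=.
apply: eq_bigr => p _.
rewrite -[\sum_y _]/(gpair (fun y => lamH2 X Y (p * y)%g) (Ru k v)) gpair_Ru mulrCA.
by rewrite /lamH2 /= !mulg1 !lamH_v -!mulrDr -mulrBr.
Qed.

Lemma R_Ru_nondeg_in v (f : gT -> k) :
    v \in H -> (forall x, v * x = x * v)%g -> (v * v = 1)%g ->
    {in H, forall y, \sum_(x in H) f x * (R * Ru k v) (x, y) = 0} ->
  {in H, forall x, f x = 0}.
Proof.
move=> Hv vC vv f0; have [X Xf] := lamH_onto f.
suff X0 : X = 0 by move=> x Hx; rewrite -Xf // X0 /rconj mulmx0 mul0mx linear0.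
apply: (@beta_Ru_nondeg v) => // Y.
apply: (mulfI (invr_neq0 two_neq0)); rewrite mulr0 -R_Ru_beta //.
rewrite /lamH2 gpair_lamH.
rewrite (eq_bigr (fun x =>
  \sum_y (R * Ru k v) (x, y) * lamH Y y * lamH X x)) => [|x _]; last first.
  by rewrite mulr_suml.
rewrite exchange_big big1 // => y _ /=.
rewrite (eq_bigr (fun x =>
  lamH Y y * (lamH X x * (R * Ru k v) (x, y)))) => [|x _]; last first.
  by rewrite mulrAC mulrC; congr (_ * _); apply: mulrC.
rewrite -mulr_sumr; have [Hy|/negPf yH] := boolP (y \in H); last by rewrite /lamH yH mul0r.
rewrite (bigID (mem H)) /= [X in _ + X]big1 => [|x /negPf xH]; last by rewrite /lamH xH mul0r.
rewrite addr0 (eq_bigr (fun x => f x * (R * Ru k v) (x, y))) ?f0 ?mulr0 // => x Hx.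
by rewrite /lamH Hx Xf.
Qed.

Hypothesis uC : forall x, (u * x = x * u)%g.
Hypothesis uu : (u * u = 1)%g.
Hypothesis Hgen : forall x, (x \in H) || ((x * u)%g \in H).

(** If [u] is outside [H], the values of the contraction at [y] and [y u] are half
the contractions of [R] with [f(x) + f(xu)] and with [f(x) - f(xu)]. *)
Lemma R_Ru_nondeg (f : gT -> k) :
  (forall y, \sum_x f x * (R * Ru k u) (x, y) = 0) -> forall x, f x = 0.
Proof.
move=> f0; have uV : (u^-1 = u)%g by apply/eqP; rewrite eq_invg_mul uu.
have [Hu|uH] := boolP (u \in H).
  have HT x : x \in H by have := Hgen x; rewrite groupMr // orbb.
  move=> x; apply: (@R_Ru_nondeg_in u) => // y _; rewrite -[RHS](f0 y).
  by apply: eq_bigl => z; rewrite HT.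
have mulu x : x \in H -> (x * u)%g \notin H by move=> Hx; rewrite groupMl.
have RRuE x y : (R * Ru k u) (x, y) =
    2%:R^-1 * (R (x, y) + R (x, y * u) + R (x * u, y) - R (x * u, y * u))%g.
  rewrite /Ru !tens_gelt -scalerAr [R * _]mulrBr ![R * (_ + _)]mulrDr.
  have gV (a b : gT) : (R * gelt k ((a, b) : G2)) (x, y) = R (x * a^-1, y * b^-1)%g.
    by rewrite mul_geltE.
  have cD (a b : A2) p : (a + b) p = a p + b p by rewrite ffunE.
  have cB (a b : A2) p : (a - b) p = a p - b p by rewrite !ffunE.
  have cZ t (a : A2) p : (t *: a) p = t * a p by rewrite ffunE.
  by rewrite cZ cB !cD !gV invg1 uV !mulg1.
have R0r x y : y \notin H -> R (x, y) = 0.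
  by move=> yH; apply: R_supp; rewrite inHH /= (negPf yH) andbF.
have R0l x y : x \notin H -> R (x, y) = 0.
  by move=> xH; apply: R_supp; rewrite inHH /= (negPf xH).
have Ru1 : Ru k (1%g : gT) = 1.
  by rewrite /Ru !tens_gelt addrK -mulr2n -scaler_nat scalerA mulVf // scale1r.
have nd (g : gT -> k) : {in H, forall y, \sum_x g x * R (x, y) = 0} ->
    {in H, forall x, g x = 0}.
  (* R itself is the case v = 1, as R_1 = 1. *)
  move=> g0; apply: (@R_Ru_nondeg_in 1%g) => [||//|y Hy]; rewrite ?mulg1 //.
    by move=> x; rewrite mul1g mulg1.
  rewrite Ru1 mulr1 -[RHS](g0 y Hy) [RHS](bigID (mem H)) /=.
  by rewrite [X in _ = _ + X]big1 ?addr0 // => x xH; rewrite R0l ?mulr0.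
have shift (g : gT -> k) y : \sum_x g x * R (x * u, y)%g = \sum_x g (x * u)%g * R (x, y).
  rewrite (reindex_inj (mulIg u)) /=; apply: eq_bigr => x _.
  by rewrite -mulgA uu mulg1.
have half (a : k) : 2%:R^-1 * a = 0 -> a = 0.
  by move/eqP; rewrite mulf_eq0 invr_eq0 (negPf two_neq0) => /eqP.
have fplus : {in H, forall x, f x + f (x * u)%g = 0}.
  apply: (nd (fun x => f x + f (x * u)%g)) => y Hy.
  apply: half; rewrite -[RHS](f0 y) mulr_sumr.
  rewrite [RHS](eq_bigr (fun x => 2%:R^-1 * (f x * R (x, y)) +
    2%:R^-1 * (f x * R (x * u, y)%g))); last first.
    move=> x _; rewrite RRuE (R0r x _ (mulu y Hy)) (R0r (x * u)%g _ (mulu y Hy)).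
    by rewrite addr0 subr0 mulrCA [f x * (_ + _)]mulrDr mulrDr.
  rewrite [RHS]big_split /= -[X in _ = _ + X]mulr_sumr shift mulr_sumr -big_split /=.
  by apply: eq_bigr => x _; rewrite mulrDl mulrDr.
have fminus : {in H, forall x, f x - f (x * u)%g = 0}.
  apply: (nd (fun x => f x - f (x * u)%g)) => y Hy.
  apply: half; rewrite -[RHS](f0 (y * u)%g) mulr_sumr.
  rewrite [RHS](eq_bigr (fun x => 2%:R^-1 * (f x * R (x, y)) -
    2%:R^-1 * (f x * R (x * u, y)%g))); last first.
    move=> x _; rewrite RRuE (R0r x _ (mulu y Hy)) (R0r (x * u)%g _ (mulu y Hy)).
    by rewrite add0r addr0 -mulgA uu mulg1 mulrCA [f x * (_ - _)]mulrBr mulrBr.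
  rewrite [RHS]sumrB /= -[X in _ = _ - X]mulr_sumr shift mulr_sumr -sumrB /=.
  by apply: eq_bigr => x _; rewrite mulrBl mulrBr.
have fH x : x \in H -> f x = 0 /\ f (x * u)%g = 0.
  move=> Hx; have := fplus x Hx; have := fminus x Hx.
  move=> /eqP; rewrite subr_eq0 => /eqP-> /eqP.
  by rewrite -mulr2n -mulr_natl mulf_eq0 (negPf two_neq0) => /eqP.
move=> x; have /orP[/fH[]//|/fH[_]] := Hgen x.
by rewrite -mulgA uu mulg1.
Qed.

End Nondeg.

(** * Minimality *)

Lemma matrix_minimal (u : gT) :
    u \in 'Z([set: gT])%g -> (u ^+ 2 = 1)%g ->
  is_minimal (FHVu H gamma u) <-> <<u |: H>>%g = [set: gT].
Proof.
move=> uZ; rewrite expgS expg1 => uu.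
have uC x : (u * x = x * u)%g by apply: u_comm.
have [K [KH KJ betaK]] := twist_inverse.
have JK := galg_unit KJ.
have JV : J^-1 = K by apply: galg_invE.
have fJV : (flip J)^-1 = gpush (@swapg gT) K.
  apply: galg_invE; rewrite flipE -(gpush_mul _ _ (@swapgM gT)) JK.
  exact: (gpush_gelt k (@swapg gT)).
have rT : rmat (FHVu H gamma u) = gpush (@swapg gT) K * J * Ru k u.
  by rewrite /= fJV tens11 mulr1.
have cT a : comul (FHVu H gamma u) a = K * gpush (@diagg gT) a * J.
  by rewrite -comul_groupE -JV.
have tri : is_triangular_hopf (FHVu H gamma u).
  apply: (twisted_Ru_triangular_hopf two_neq0 uZ uu JK) => //.
  - exact: twist_twist.
  - exact: twist_fst.
  - exact: twist_snd.
have sKH : supported HH (gpush (@swapg gT) K).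
  by apply: supported_gpush KH => p; rewrite !inHH andbC.
have RH : supported HH (gpush (@swapg gT) K * J).
  by apply: supportedM => //; apply: twist_supp.
split=> [[_ Lsurj _]|gen]; last first.
  (* Since u is central of order at most 2, H and Hu already form a group. *)
  have Hgen x : (x \in H) || ((x * u)%g \in H).
    pose S := [set x | (x \in H) || ((x * u)%g \in H)].
    have gS : group_set S.
      apply/group_setP; split=> [|a b]; rewrite !inE ?group1 //.
      case/orP=> Ha; case/orP=> Hb.
      - by rewrite groupM.
      - by rewrite -mulgA [X in _ || X]groupM ?orbT.
      - by rewrite -mulgA -[(b * u)%g]uC mulgA [X in _ || X]groupM ?orbT.
      - suff -> : (a * b = (a * u) * (b * u))%g by rewrite groupM.
        by rewrite -mulgA -[(b * u)%g]uC [(u * (u * b))%g]mulgA uu mul1g.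
    have /subsetP/(_ x) : <<u |: H>>%g \subset Group gS.
      rewrite gen_subG; apply/subsetP => y; rewrite !inE.
      by case/orP=> [/eqP->|->//]; rewrite uu group1 orbT.
    by rewrite gen !inE; apply.
  have nd := R_Ru_nondeg RH betaK uC uu Hgen.
  by split=> // a; rewrite rT; [apply: contract_left_surj | apply: contract_right_surj].
apply/eqP; rewrite eqEsubset subsetT; apply/subsetP => g _.
set B := <<u |: H>>%G; apply/negPn/negP => gB.
have BB p : (p \in [group of setX B B]) = (p.1 \in B) && (p.2 \in B) by rewrite inE.
have uB : u \in B by rewrite mem_gen // setU11.
have HB x : x \in H -> x \in B by move=> Hx; rewrite mem_gen // inE Hx orbT.
have Rsupp : supported [group of setX B B] (rmat (FHVu H gamma u)).
  rewrite rT; apply: supportedM.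
    move=> p pB; apply: RH; apply: contra pB.
    by rewrite inHH BB => /andP[/HB-> /HB->].
  rewrite /Ru !tens_gelt => p pB.
  have gp a b : a \in B -> b \in B -> gelt k ((a, b) : G2) p = 0.
    move=> Ba Bb; rewrite ffunE (_ : (_ == _) = false) //.
    by apply: contraNF pB => /eqP->; rewrite BB Ba.
  have cD (a b : A2) : (a + b) p = a p + b p by rewrite ffunE.
  have cB (a b : A2) : (a - b) p = a p - b p by rewrite !ffunE.
  have cZ t (a : A2) : (t *: a) p = t * a p by rewrite ffunE.
  by rewrite cZ cB !cD !gp ?group1 // subr0 !addr0 mulr0.
(* Outside the subgroup generated by H and u every contraction vanishes. *)
have [f /ffunP/(_ g)] := Lsurj (gelt k g).
rewrite !ffunE eqxx (_ : [ffun x => _] = 0) ?linear0; last first.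
  apply/ffunP => x; rewrite [LHS]ffunE [RHS]ffunE; apply: Rsupp.
  by rewrite BB /= negb_and gB orbT.
by move/eqP; rewrite eq_sym oner_eq0.
Qed.

End MatrixTwist.

(** * Transport from End V to matrices *)

Import passmx.

Section EndMatrix.
Variables (k : fieldType) (V : vectType k).
Local Notation n := (\dim {:V}).
Let e := vbasis {:V}.
Let e_basis : basis_of {:V} e := vbasisP {:V}.

(** [mxof] gives the matrix acting on row vectors; the transpose makes the
correspondence multiplicative rather than antimultiplicative. *)
Definition end_mx (f : 'End(V)) : 'M[k]_n := (mxof e e f)^T.
Definition mx_end (X : 'M[k]_n) : 'End(V) := hommx e e X^T.

Lemma end_mxK f : mx_end (end_mx f) = f.
Proof. by rewrite /mx_end /end_mx trmxK mxofK. Qed.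

Lemma mx_endK X : end_mx (mx_end X) = X.
Proof. by rewrite /mx_end /end_mx hommxK // trmxK. Qed.

Fact mx_end_is_linear : linear mx_end.
Proof. by move=> t X Y; rewrite /mx_end !linearP. Qed.
HB.instance Definition _ :=
  GRing.isLinear.Build k 'M[k]_n 'End(V) _ mx_end mx_end_is_linear.

Lemma mx_end_mul X Y : mx_end (X *m Y) = (mx_end X \o mx_end Y)%VF.
Proof. by rewrite /mx_end trmx_mul (hommx_mul e_basis e_basis e_basis). Qed.

Lemma mx_end1 : mx_end 1%:M = \1%VF.
Proof. by rewrite /mx_end trmx1 hommx1. Qed.

Lemma end_mx_comp f g : end_mx (f \o g)%VF = end_mx f *m end_mx g.
Proof. by rewrite -[RHS]mx_endK mx_end_mul !end_mxK. Qed.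

Lemma end_mx1 : end_mx \1%VF = 1%:M.
Proof. by rewrite -mx_end1 mx_endK. Qed.

Lemma end_mxZ t f : end_mx (t *: f) = t *: end_mx f.
Proof. by rewrite -[RHS]mx_endK linearZ /= end_mxK. Qed.

Fact end_mx_is_linear : linear end_mx.
Proof. by move=> t f g; rewrite /end_mx !linearP. Qed.
HB.instance Definition _ :=
  GRing.isLinear.Build k 'End(V) 'M[k]_n _ end_mx end_mx_is_linear.

Lemma end_mx_unit f : lker f == 0%VS ->
  end_mx f \in unitmx /\ end_mx f^-1%VF = invmx (end_mx f).
Proof.
move=> /lker0_compfV/(congr1 end_mx); rewrite end_mx_comp end_mx1 => ff.
have [u _] := mulmx1_unit ff; split=> //.
by rewrite -[LHS](mulKmx u) ff mulmx1.
Qed.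

End EndMatrix.

Theorem proposition5p3 (k : closedFieldType) (char0 : [pchar k] =i pred0)
    (gT : finGroupType) (H : {group gT})
    (V : vectType k) (rho : gT -> 'End(V)) (u : gT)
    (irr_rho : is_proj_irr H rho)
    (dimV : ((\dim {:V}) ^ 2 = #|H|)%N)
    (u_central : u \in 'Z([set: gT])%g) (u_order : (u ^+ 2 = 1)%g)
    (lam : 'Hom('End(V), k^o)) (gamma : gT -> gT -> k)
    (lam_gen : is_dual_generator H rho lam)
    (gammaP : is_comul_coef H rho lam gamma) :
  is_minimal (FHVu H gamma u) <-> <<u |: H>>%g = [set: gT].
Proof.
have [[rho_inj rhoM] _ _] := irr_rho; have [lam_basis lam1] := lam_gen.
pose r x := end_mx (rho x).
pose lamM : {linear 'M[k]_(\dim {:V}) -> k^o} := lam \o @mx_end k V.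
have dualE x X : x \in H -> dual_act rho x lam X = lamM (rconj r (end_mx X) x).
  move=> Hx; pose act (X : 'End(V)) : k^o := lam ((rho x)^-1 \o X \o rho x)%VF.
  have actL : linear act.
    by move=> t Y Z; rewrite /act comp_lfunDr comp_lfunDl -comp_lfunZr -comp_lfunZl linearP.
  pose F : {linear 'End(V) -> k^o} := HB.pack act (GRing.isLinear.Build k _ _ _ act actL).
  rewrite /dual_act -[linfun _]/(linfun F) lfunE /= /rconj.
  have [_ <-] := end_mx_unit (rho_inj x Hx).
  by rewrite -!end_mx_comp end_mxK.
have dualM x X : x \in H -> lamM (rconj r X x) = dual_act rho x lam (mx_end X).
  by move=> Hx; rewrite dualE // mx_endK.
pose D : #|H|.-tuple 'Hom('End(V), k^o) :=
  [tuple of map (dual_act rho ^~ lam) (enum_tuple H)].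
have D_nth (i : 'I_#|H|) : D`_i = dual_act rho (enum_val i) lam.
  by rewrite (nth_map 1%g) ?size_tuple // -enum_val_nth.
have D_basis : basis_of fullv D by [].
have natr_neq0 := (pcharf0P k).1 char0.
have n_neq0 : (\dim {:V})%:R != 0 :> k.
  by rewrite natr_neq0; apply: contraTneq (cardG_gt0 H) => d0; rewrite -dimV d0.
have two_neq0 : 2%:R != 0 :> k by rewrite natr_neq0.
have r_unit : {in H, forall x, r x \in unitmx}.
  by move=> x Hx; have [] := end_mx_unit (rho_inj x Hx).
have r_mul : {in H &, forall x y,
    exists2 c : k, c != 0 & r (x * y)%g = c *: (r x *m r y)}.
  move=> x y Hx Hy; have [c c0 e] := rhoM x y Hx Hy; exists c => //.
  by rewrite /r e end_mxZ end_mx_comp.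
have lam_free (t : gT -> k) : (forall X, \sum_(h in H) t h * lamM (rconj r X h) = 0) ->
    {in H, forall h, t h = 0}.
  move=> t0 h Hh; rewrite -(enum_rankK_in (group1 H) Hh).
  have /freeP/(_ (fun i => t (enum_val i))) := basis_free D_basis.
  apply; apply/lfunP => f.
  rewrite zero_lfunE sum_lfunE -[RHS](t0 (end_mx f)) [RHS]big_enum_val.
  by apply: eq_bigr => i _; rewrite D_nth scale_lfunE dualM ?enum_valP // end_mxK.
have lam_span (f : {linear 'M[k]_(\dim {:V}) -> k^o}) :
    exists t, forall X, f X = \sum_(h in H) t h * lamM (rconj r X h).
  pose g : 'Hom('End(V), k^o) := linfun (f \o @end_mx k V).
  exists (fun x => coord D (enum_rank_in (group1 H) x) g) => X.
  have -> : f X = g (mx_end X) by rewrite lfunE /= mx_endK.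
  rewrite {1}(coord_basis D_basis (memvf g)) sum_lfunE [RHS]big_enum_val.
  by apply: eq_bigr => i _; rewrite D_nth scale_lfunE dualM ?enum_valP // enum_valK_in.
have lamM1 : lamM 1%:M = 1 by rewrite /= mx_end1.
have gammaM X Y : lamM (X *m Y) =
    \sum_(a in H) \sum_(b in H) gamma a b * (lamM (rconj r X a) * lamM (rconj r Y b)).
  rewrite /= mx_end_mul gammaP; apply: eq_bigr => a Ha; apply: eq_bigr => b Hb.
  by rewrite -!dualM.
have [L lamL] := tau_dual lamM n_neq0.
exact: (matrix_minimal r_unit r_mul lam_free lam_span lamM1 (esym dimV) n_neq0 lamL
  two_neq0 gammaM u_central u_order).
Qed.
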